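(* Let $\nu>2$ and let $\rho$ be a semimetric on $\mathcal F$. Assume: (1) There exists $g:\mathbb N\times(0,\infty)\to\mathbb R$ such that for each $n\in\mathbb N$, $\delta>0$ and $1\le i\le j\le n$, $\mathrm E^*\{\sup_{f\in\mathcal F_\delta}|S_{n,i,j}^{Z^o}(f)|^\nu\}\le g^{\nu/2}(j-i+1,\delta)$; and there exists a single index $Q_g\in[1,2^{1-2/\nu})$ such that for each $\delta>0$ the pair $(\nu/2,g(\cdot,\delta))$ fulfills condition (S) with index $Q_g$. (2) There exists $h:\mathbb N\to\mathbb R$ such that for each $n\in\mathbb N$ and $1\le i\le j\le n$, $\mathrm E^*\{\sup_{f\in\mathcal F}|S_{n,i,j}^{Z^o}(f)|^\nu\}\le h^{\nu/2}(j-i+1)$; and the pair $(\nu/2,h)$ fulfills condition (S) with some index $Q_h\in[1,2^{1-2/\nu})$. (3) $\lim_{\delta\downarrow0}\limsup_{n\to\infty} g(n,\delta)/n=0$. (4) There exists a constant $C\ge0$ such that for each $0<\varepsilon\le1$, $\limsup_{n\to\infty} h(\lfloor n\varepsilon\rfloor)/n\le C\varepsilon$ (with the convention $h(0)=0$). Then $\mathbb Z_n$ satisfies (AEC) for the semimetric $\tau((s,f),(t,g))=|s-t|+\rho(f,g)$ on $[0,1]\times\mathcal F$. If, in addition, $(\mathcal F,\rho)$ is totally bounded, then convergence of the finite-dimensional marginals of $\mathbb Z_n$ to those of a tight Borel measurable $\mathbb Z$ implies weak convergence $\mathbb Z_n\Rightarrow\mathbb Z$ in $\ell^\infty([0,1]\times\mathcal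 F)$.
   Context: Let $(\Omega,\Upsilon,P)$ be a probability space, $(\mathcal X,\mathcal A)$ a measurable space, and $(X_{i,n})_{1\le i\le n,\,n\in\mathbb N}$ an array of $\mathcal X$-valued random variables. $\mathcal F$ is a family of Borel measurable maps $\mathcal X\to\mathbb R$ possessing a finite measurable envelope $F$, i.e. $\sup_{f\in\mathcal F}|f(x)|\le F(x)<\infty$ for all $x$ and $\mathrm E\{F(X_{i,n})\}<\infty$ for all $i,n$. The sequential empirical process is $\mathbb Z_n(t,f)=n^{-1/2}\sum_{i=1}^{\lfloor nt\rfloor}(f(X_{i,n})-\mathrm E f(X_{i,n}))$, $t\in[0,1]$, $f\in\mathcal F$, viewed as a (possibly nonmeasurable) map into $\ell^\infty([0,1]\times\mathcal F)$ (bounded functions with sup norm). $\mathcal F_\delta=\{f-g: f,g\in\mathcal F,\ \rho(f,g)\le\delta\}$. For $g\in\mathcal F\cup\bigcup_{\delta>0}\mathcal F_\delta$, $Z^o_{k,n}(g)=g(X_{k,n})-\mathrm E g(X_{k,n})$ and $S^{Z^o}_{n,i,j}(g)=\sum_{k=i}^j Z^o_{k,n}(g)$. $\mathrm E^*$ and $P^*$ denote outer expectation and outer probability ($P^*(B)=\inf\{P(A):B\subset A\in\Upsilon\}$). Condition (S): for $\alpha>1$ and $g:\mathbb N\to\mathbb R$, $(\alpha,g)$ fulfills (S) with index $Q\in[1,2^{(\alpha-1)/\alpha})$ if $g\ge0$, $g$ is nondecreasing, and $g(i)+g(j-i)\le Qg(j)$ for all $1\le i<j$. (AEC) for $\tau$: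 for every $\varepsilon>0$, $\lim_{\delta\downarrow0}\limsup_{n\to\infty}P^*(\sup_{\tau((s,f),(t,g))\le\delta}|\mathbb Z_n(s,f)-\mathbb Z_n(t,g)|>\varepsilon)=0$. Weak convergence $\mathbb Z_n\Rightarrow\mathbb Z$ (Hoffmann-Jørgensen sense) means $\mathrm E^*\{h(\mathbb Z_n)\}\to\mathrm E\{h(\mathbb Z)\}$ for all bounded continuous $h:\ell^\infty([0,1]\times\mathcal F)\to\mathbb R$. *)

(* Defs.v *)
From HB Require Import structures.
From mathcomp Require Import all_boot all_order all_algebra.
From mathcomp Require Import all_classical all_reals all_analysis.
From mathcomp Require Import measurable_realfun.
Set Implicit Arguments. Unset Strict Implicit. Unset Printing Implicit Defensive.
Import Order.TTheory GRing.Theory Num.Theory.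
Import numFieldNormedType.Exports.
Local Open Scope classical_set_scope.
Local Open Scope ring_scope.

Section Outer.
Context {R : realType} {d : measure_display} {Omega : measurableType d}.
Variable P : probability Omega R.

Definition Estar (Y : Omega -> \bar R) : \bar R :=
  ereal_inf [set (\int[P]_w U w)%E | U in
    [set U : Omega -> \bar R | measurable_fun setT U /\ (forall w, (Y w <= U w)%E)
       /\ ((\int[P]_w funepos U w < +oo)%E \/ (\int[P]_w funeneg U w < +oo)%E)]].

Definition Pstar (B : set Omega) : \bar R :=
  ereal_inf [set P A | A in [set A : set Omega | measurable A /\ B `<=` A]].

Definition Eval (Y : Omega -> R) : R := fine (\int[P]_w (Y w)%:E)%E.
End Outer.

(* condition (S) for (alpha, g) with index Q; g is defined on N = {1,2,...} *)
Definition condS {R : realType} (alpha : R) (g : nat -> R) (Q : R) : Prop :=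
  [/\ 1 <= Q, Q < 2 `^ ((alpha - 1) / alpha),
      (forall i, (1 <= i)%N -> 0 <= g i),
      (forall i j, (1 <= i <= j)%N -> g i <= g j) &
      (forall i j, (1 <= i < j)%N -> g i + g (j - i)%N <= Q * g j)].

Definition semimetric {T : Type} {R : realType} (Fam : set T) (rho : T -> T -> R) :=
  forall f g h, Fam f -> Fam g -> Fam h ->
    [/\ 0 <= rho f g, rho f f = 0, rho f g = rho g f & rho f h <= rho f g + rho g h].

Definition totally_bounded {T : Type} {R : realType} (Fam : set T) (rho : T -> T -> R) :=
  forall e : R, 0 < e -> exists G : set T,
    [/\ finite_set G, G `<=` Fam & forall f, Fam f -> exists2 g, G g & rho f g < e].

Section Linf.
Context {R : realType} {T : Type}.

Definition supdist (x y : T -> R) : \bar R :=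
  ereal_sup (range (fun t => (`|x t - y t|)%:E)).

Definition linf : set (T -> R) := [set x | exists M : R, forall t, `|x t| <= M].

Definition linf_open (U : set (T -> R)) : Prop :=
  U `<=` linf /\ forall x, U x -> exists2 e : R, 0 < e &
     forall y, linf y -> (supdist x y < e%:E)%E -> U y.

Definition linf_borel : set (set (T -> R)) := <<s linf_open >>.

Definition linf_compact (K : set (T -> R)) : Prop :=
  K `<=` linf /\
  forall C : set (set (T -> R)), (forall U, C U -> linf_open U) ->
    K `<=` \bigcup_(U in C) U ->
    exists2 D : set (set (T -> R)), finite_set D & D `<=` C /\ K `<=` \bigcup_(U in D) U.

Definition linf_bcont (h : (T -> R) -> R) : Prop :=
  (exists M : R, forall x, linf x -> `|h x| <= M) /\
  forall x, linf x -> forall e : R, 0 < e -> exists2 dl : R, 0 < dl &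
    forall y, linf y -> (supdist x y < dl%:E)%E -> `|h x - h y| < e.

Definition borel_linf {d} {Om : measurableType d} (Z : Om -> T -> R) : Prop :=
  (forall w, linf (Z w)) /\ forall B, linf_borel B -> measurable (Z @^-1` B).

Definition tight {d} {Om : measurableType d} (P : probability Om R) (Z : Om -> T -> R) :=
  forall e : R, 0 < e -> exists K, linf_compact K /\ ((1 - e)%:E <= P (Z @^-1` K))%E.

Definition fidi_conv {d d'} {Om : measurableType d} {Om' : measurableType d'}
  (P : probability Om R) (Zn : nat -> Om -> T -> R)
  (P' : probability Om' R) (Z : Om' -> T -> R) : Prop :=
  forall (k : nat) (p : 'I_k -> T) (phi : 'rV[R]_k -> R),
    continuous phi -> (exists M : R, forall v, `|phi v| <= M) ->
    (fun n => \int[P]_w (phi (\row_j Zn n w (p j)))%:E)%E @ \oo -->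
      (\int[P']_w (phi (\row_j Z w (p j)))%:E)%E.

Definition weak_conv {d d'} {Om : measurableType d} {Om' : measurableType d'}
  (P : probability Om R) (Zn : nat -> Om -> T -> R)
  (P' : probability Om' R) (Z : Om' -> T -> R) : Prop :=
  forall h, linf_bcont h ->
    (fun n => Estar P (fun w => (h (Zn n w))%:E)) @ \oo -->
      (\int[P']_w (h (Z w))%:E)%E.
End Linf.

Section Process.
Context {R : realType} {d dX : measure_display} {Omega : measurableType d}
  {X : measurableType dX}.
Variable P : probability Omega R.
Variable Xa : nat -> nat -> Omega -> X.  (* Xa i n = X_{i,n}, 1 <= i <= n *)

Definition Ssum (n i j : nat) (g : X -> R) (w : Omega) : R :=
  \sum_(i <= k < j.+1) (g (Xa k n w) - Eval P (g \o Xa k n)).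

Definition Zproc (n : nat) (t : R) (f : X -> R) (w : Omega) : R :=
  (Num.sqrt n%:R)^-1 * Ssum n 1 (Num.truncn (n%:R * t)) f w.

Definition Fdelta (Fam : set (X -> R)) (rho : (X -> R) -> (X -> R) -> R) (dl : R)
  : set (X -> R) :=
  [set h | exists f g, [/\ Fam f, Fam g, rho f g <= dl & h = f \- g]].
End Process.

Definition IdxT {R : realType} {X : Type} (Fam : set (X -> R)) :=
  {p : R * (X -> R) | (0 <= p.1 <= 1) /\ Fam p.2}.

Definition Zsup {R : realType} {d dX} {Omega : measurableType d}
  {X : measurableType dX} (P : probability Omega R) (Xa : nat -> nat -> Omega -> X)
  (Fam : set (X -> R)) (n : nat) (w : Omega) : IdxT Fam -> R :=
  fun p => Zproc P Xa n (proj1_sig p).1 (proj1_sig p).2 w.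
Arguments Zsup {R d dX Omega X} P Xa Fam n w.

(* Main.v *)
Require Import Defs.
From HB Require Import structures.
From mathcomp Require Import all_boot all_order all_algebra.
From mathcomp Require Import all_classical all_reals all_analysis.
From mathcomp Require Import measurable_realfun.
From mathcomp Require Import ring lra zify.
Import Order.TTheory GRing.Theory Num.Theory.
Import numFieldNormedType.Exports.
Local Open Scope classical_set_scope.
Local Open Scope ring_scope.

(* Equicontinuity rests on a Moricz-type maximal inequality: a block of length
   [l] is split where [g] is at most [Q / 2 * g l] on both sides, and convexity
   gives [(a + b)^nu <= (1 - la)^(1 - nu) a^nu + la^(1 - nu) b^nu].  Condition
   (S) says exactly that [2 (Q / 2)^(nu / 2) < 1], so for [la] close to 1 the
   induction on [l] closes with a constant depending on [nu] and [Q] only.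
   Outer expectations enter through measurable majorants of [|S|^nu], whose
   linear combinations replace Minkowski's inequality.  Applied with [g] it
   controls increments in [f]; applied with [h] on about [1 / dl] overlapping
   blocks it controls increments in time with probability [O(dl^(nu/2 - 1))].

   For weak convergence, equicontinuity and total boundedness give a
   finite-valued projection [pr] of the index set with [Zn] uniformly close to
   [Zn o pr]; the marginals transfer this to [Z] on finite subsets of the index
   set, and a compact set carrying most of [Z] transfers it to the sup norm.  For
   bounded continuous [h], [h (Zn o pr)] is a continuous function of finitely
   many marginals.  As [h] need not be uniformly continuous, it is compared
   with [h Zn] where the radius of a ball on which [h] oscillates little, a
   1-Lipschitz function of its centre, is not small at [Zn o pr]; this too is
   an event about finitely many marginals. *)

(** * The maximal inequality *)

(** Convexity of the power at [a / (1 - la)] and [b / la], whose mean with weights [1 - la] and [la]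
    is [a + b]. For [la] near 1 the coefficient of [b] is near 1, at the expense of that of [a]. *)
Lemma powR_add_le {R : realType} (la nu a b : R) :
  0 < la < 1 -> 1 <= nu -> 0 <= a -> 0 <= b ->
  (a + b) `^ nu <= (1 - la) `^ (1 - nu) * a `^ nu + la `^ (1 - nu) * b `^ nu.
Proof.
move=> /andP[la0 la1] nu1 a0 b0.
have la1' : 0 < 1 - la by rewrite subr_gt0.
have scaleE (c x : R) : 0 < c -> 0 <= x ->
    c * (x / c) `^ nu = c `^ (1 - nu) * x `^ nu.
  move=> c0 x0; rewrite powRM// ?invr_ge0 ?(ltW c0)//.
  rewrite powRD ?(gt_eqF c0) ?implybT// powRr1 ?(ltW c0)//.
  by rewrite -(powR_inv1 (ltW c0)) -powRrM mulN1r powRN mulrA mulrAC.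
rewrite [X in X `^ _ <= _](_ : _ = (1 - la) * (a / (1 - la)) + (1 - (1 - la)) * (b / la)); last first.
  by field; rewrite !gt_eqF.
have la01 : 0 <= 1 - la by exact: ltW.
have la11 : 1 - la <= 1 by rewrite gerBl ltW.
apply: (le_trans (@convex_powR R nu nu1 (Itv01 la01 la11) (a / (1 - la)) (b / la) _ _)).
- by rewrite inE/= in_itv/= andbT divr_ge0.
- by rewrite inE/= in_itv/= andbT divr_ge0// ltW.
rewrite [leLHS](_ : _ = (1 - la) * (a / (1 - la)) `^ nu
  + (1 - (1 - la)) * (b / la) `^ nu)//.
by rewrite scaleE// (_ : 1 - (1 - la) = la) ?scaleE//; ring.
Qed.

(** The pointwise infimum of countably many measurable near-minimisers is again a measurable
    majorant, and its integral is below each of theirs: the outer expectation is attained. *)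
Lemma Estar_majorant {R : realType} {d} {Omega : measurableType d}
    (P : probability Omega R) (Y : Omega -> \bar R) (c : R) :
  (forall w, (0 <= Y w)%E) -> (Estar P Y <= c%:E)%E ->
  exists U : Omega -> \bar R, [/\ measurable_fun setT U,
    forall w, (0 <= U w)%E, forall w, (Y w <= U w)%E &
    (\int[P]_w U w <= c%:E)%E].
Proof.
move=> Y0 Yc.
have approx k : exists U : Omega -> \bar R, [/\ measurable_fun setT U,
    forall w, (Y w <= U w)%E & (\int[P]_w U w <= (c + k.+1%:R^-1)%:E)%E].
  have : (Estar P Y < (c + k.+1%:R^-1)%:E)%E.
    by apply: le_lt_trans Yc _; rewrite lte_fin ltrDl invr_gt0.
  move=> /ereal_inf_lt[_ [U [mU [YU _]] <-] /ltW ?]; by exists U.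
have /choice[U UP] := approx.
pose V w := ereal_inf [set U k w | k in [set k | (0 <= k)%N]].
have VU k w : (V w <= U k w)%E by apply: ereal_inf_lbound; exists k.
have YV w : (Y w <= V w)%E.
  by apply: le_ereal_inf_tmp => _ [k _ <-]; have [_ ] := UP k.
have V0 w : (0 <= V w)%E by exact: le_trans (YV w).
have mV : measurable_fun setT V.
  by apply: (@measurable_fun_einfs _ _ _ _ U _ 0%N) => k; have [] := UP k.
exists V; split => //.
apply/lee_addgt0Pr => e e0.
have [k ke] : exists k, k.+1%:R^-1 < e :> R.
  exists (Num.truncn e^-1); rewrite invf_plt ?posrE//.
  exact: truncnS_gt.
have [mU _ intU] := UP k.
apply: (@le_trans _ _ (\int[P]_w U k w)%E).
  by apply: ge0_le_integral => // w _; rewrite V0.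
by apply: le_trans intU _; rewrite -EFinD lee_fin lerD2l ltW.
Qed.

(** Take the largest length below [l] at which [g] is at most half of [Q * g l]. One step further
    [g] exceeds that half, so the splitting inequality bounds what remains. If nothing remains,
    [g 0 = 0] applies. *)
Lemma balanced_split {R : realType} (Q : R) (g : nat -> R) (l : nat) :
  0 <= Q -> (0 < l)%N -> g 0%N = 0 -> 0 <= g l ->
  (forall i, (1 <= i < l)%N -> g i + g (l - i)%N <= Q * g l) ->
  exists m, [/\ (0 < m <= l)%N, g m.-1 <= Q / 2 * g l & g (l - m)%N <= Q / 2 * g l].
Proof.
move=> Q0 l0 g0 gl0 gQ.
have Qg0 : 0 <= Q / 2 * g l by rewrite !mulr_ge0.
pose ok m := (m < l)%N && (g m <= Q / 2 * g l).
have ok0 : exists m, ok m by exists 0%N; rewrite /ok l0 g0.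
have okb m : ok m -> (m <= l)%N by case/andP => /ltnW.
case: (ex_maxnP ok0 okb) => m /andP[ml gm] mmax.
exists m.+1; split => //=.
case: (ltnP m.+1 l) => [ml'|lm]; last first.
  by rewrite (_ : l - m.+1 = 0)%N ?g0//; apply/eqP; rewrite subn_eq0.
have gm1 : Q / 2 * g l < g m.+1.
  rewrite ltNge; apply/negP => gm1.
  by have := mmax m.+1; rewrite /ok ml' gm1 => /(_ isT); rewrite ltnn.
have := gQ m.+1; rewrite ml' => /(_ isT).
by lra.
Qed.

Lemma powR_lt1_contraction {R : realType} (nu q : R) : 1 < nu -> 0 < q < 1 ->
  exists2 la : R, 0 < la < 1 & la `^ (1 - nu) * q < 1.
Proof.
move=> nu1 /andP[q0 q1].
have nu0 : 0 < nu - 1 by rewrite subr_gt0.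
have x0 : 0 < (1 + q) / 2 by lra.
have x1 : (1 + q) / 2 < 1 by lra.
exists (((1 + q) / 2) `^ (nu - 1)^-1).
  rewrite powR_gt0//= -[ltRHS](congr1 (@^~ (nu - 1)^-1) (@powR1 R)).
  by apply: gt0_ltr_powR; rewrite ?nnegrE ?invr_gt0 ?(ltW x0).
rewrite -powRrM (_ : _ * (1 - nu) = -1); last by field; rewrite gt_eqF.
by rewrite (powR_inv1 (ltW x0)) mulrC ltr_pdivrMr// mul1r; lra.
Qed.

(** Raised to the power [al], the bound on the index reads [Q^al < 2^(al - 1)]. The quantity is the
    factor lost when two halves, each with [g] at most [Q / 2] of the whole, are added. *)
Lemma split_exponent_lt1 {R : realType} (al Q : R) : 1 < al -> 1 <= Q ->
  Q < 2 `^ ((al - 1) / al) -> 0 < 2 * (Q / 2) `^ al < 1.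
Proof.
move=> al1 Q1 Q2.
have al0 : 0 < al by lra.
have Q0 : 0 < Q by lra.
rewrite mulr_gt0 ?powR_gt0 ?divr_gt0//=.
have : Q `^ al < (2 `^ ((al - 1) / al)) `^ al.
  by apply: gt0_ltr_powR => //; rewrite nnegrE ?powR_ge0 ?ltW.
rewrite -powRrM (_ : _ * al = al - 1); last by field; rewrite gt_eqF.
rewrite powRM ?invr_ge0 ?(ltW Q0)// -(powR_inv1 (ler0n R 2)) -powRrM mulN1r powRN.
rewrite powRD ?pnatr_eq0 ?implybT// (powR_inv1 (ler0n R 2)).
have p0 : 0 < 2 `^ al :> R by rewrite powR_gt0.
rewrite mulrA ltr_pdivrMr// mul1r; lra.
Qed.

(** A measurable majorant common to all indices witnesses a bound on the outer expectation of the
    supremum. Such witnesses can be added and scaled, and their integrals are linear. *)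
Definition dominated {R : realType} {d} {Omega : measurableType d}
    (P : probability Omega R) {I : Type} (D : set I) (y : I -> Omega -> R)
    (c : R) : Prop :=
  exists T : Omega -> \bar R, [/\ measurable_fun setT T, forall w, (0 <= T w)%E,
    (\int[P]_w T w <= c%:E)%E & forall i w, D i -> ((y i w)%:E <= T w)%E].

(** Strong induction on [l] with a cut [s]. Partial sums shorter than [s] belong to the left part;
    the others are the full block of length [s], bounded by hypothesis, plus a partial sum of the
    right part. Only the two parts use the induction hypothesis, and they carry the factor [c2]. *)
Lemma maximal_inequality {R : realType} (nu Q : R) :
  2 < nu -> 1 <= Q -> Q < 2 `^ ((nu / 2 - 1) / (nu / 2)) ->
  exists2 A : R, 0 <= A &
  forall d (Omega : measurableType d) (P : probability Omega R) (I : Type)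
    (D : set I) (z : nat -> I -> Omega -> R) (g : nat -> R) (n : nat),
    g 0%N = 0 -> (forall l, 0 <= g l) ->
    (forall i j, (i <= j)%N -> g i <= g j) ->
    (forall i l, (1 <= i < l)%N -> g i + g (l - i)%N <= Q * g l) ->
    (forall i l, (0 < i)%N -> (0 < l)%N -> (i + l <= n.+1)%N ->
      dominated P D (fun f w => `|\sum_(i <= k < i + l) z k f w| `^ nu)
        (g l `^ (nu / 2))) ->
    forall i l, (0 < i)%N -> (i + l <= n.+1)%N ->
      dominated P [set p : I * nat | D p.1 /\ (p.2 <= l)%N]
        (fun p w => `|\sum_(i <= k < i + p.2) z k p.1 w| `^ nu)
        (A * g l `^ (nu / 2)).
Proof.
move=> nu2 Q1 Q2.
have nu0 : 0 < nu by lra.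
have nu1 : 1 < nu by lra.
have q01 : 0 < 2 * (Q / 2) `^ (nu / 2) < 1 by apply: split_exponent_lt1 => //; lra.
set q := 2 * _ in q01.
have [la la01 laq] := powR_lt1_contraction _ _ nu1 q01.
have /andP[la0 la1] := la01.
set c1 := (1 - la) `^ (1 - nu); set c2 := la `^ (1 - nu) in laq *.
have c1_ge0 : 0 <= c1 by exact: powR_ge0.
have c2_ge0 : 0 <= c2 by exact: powR_ge0.
(* This lets [c2 * T1] also cover the partial sums of the left part, which are not split. *)
have c2_ge1 : 1 <= c2.
  have := @ger_powR R la _ (1 - nu) 0; rewrite la0 (ltW la1) powRr0.
  by apply => //; lra.
(* The fixed point of [A = c1 + c2 * q * A], so the induction closes with the same constant. *)
pose A := c1 / (1 - c2 * q).
have AE : c1 + c2 * q * A = A by rewrite /A; field; lra.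
have A0 : 0 <= A by rewrite mulr_ge0// invr_ge0 subr_ge0 ltW.
clearbody A; exists A => //.
move=> d Omega P I D z g n g0 g_ge0 g_nd gQ base i l.
have [m lm] := ubnP l; elim: m l lm i => // m IH l lm i i0 il.
have [->|l0] := posnP l.
  exists (cst 0%E); split => //; rewrite ?integral0 ?lee_fin ?mulr_ge0 ?powR_ge0//.
  move=> [f k] w/= [_]; rewrite leqn0 => /eqP ->.
  by rewrite addn0 big_geq// normr0 powR0 ?gt_eqF.
have [s [/andP[s0 sl] gs gls]] := balanced_split _ _ _ (le_trans ler01 Q1) l0 g0 (g_ge0 l)
  (fun i => gQ i l).
have s1l : (s.-1 < m)%N by clear -s0 sl lm; lia.
have lsl : (l - s < m)%N by clear -s0 sl lm; lia.
have il1 : (i + s.-1 <= n.+1)%N by clear -s0 sl il; lia.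
have il2 : (i + s + (l - s) <= n.+1)%N by clear -s0 sl il; lia.
have is0 : (0 < i + s)%N by clear -s0; lia.
have iu : (i + s <= n.+1)%N by clear -s0 sl il; lia.
have [T1 [mT1 T10 intT1 T1P]] := IH _ s1l _ i0 il1.
have [T2 [mT2 T20 intT2 T2P]] := IH _ lsl _ is0 il2.
have [U [mU U0 intU UP]] := base _ _ i0 s0 iu.
(* The sum [T1 + T2] stands for the maximum over the two parts; hence the factor 2 in [q]. *)
pose W w := (c1%:E * U w + c2%:E * (T1 w + T2 w))%E.
have mT12 : measurable_fun setT (T1 \+ T2)%E by exact: emeasurable_funD.
exists W; split.
- by apply: emeasurable_funD; apply: measurable_funeM.
- by move=> w; rewrite adde_ge0 ?mule_ge0 ?adde_ge0 ?lee_fin.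
- rewrite ge0_integralD//; last 4 first.
  + by move=> w _; rewrite mule_ge0 ?lee_fin.
  + exact: measurable_funeM.
  + by move=> w _; rewrite mule_ge0 ?adde_ge0 ?lee_fin.
  + exact: measurable_funeM.
  rewrite ge0_integralZl_EFin//.
  rewrite ge0_integralZl_EFin//; last by move=> w _; exact: adde_ge0.
  rewrite ge0_integralD//.
  have half_bound j : g j <= Q / 2 * g l -> A * g j `^ (nu / 2) <=
      A * ((Q / 2) `^ (nu / 2) * g l `^ (nu / 2)).
    move=> gj; rewrite ler_wpM2l// -powRM ?g_ge0 ?divr_ge0 ?(le_trans ler01 Q1)//.
    apply: ge0_ler_powR; rewrite ?nnegrE ?g_ge0 ?divr_ge0 ?(ltW nu0)//.
    exact: le_trans gj.
  apply: (@le_trans _ _ (c1 * g l `^ (nu / 2) + c2 *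
     (A * ((Q / 2) `^ (nu / 2) * g l `^ (nu / 2)) +
      A * ((Q / 2) `^ (nu / 2) * g l `^ (nu / 2))))%:E); last first.
    rewrite lee_fin -[in leRHS]AE /q le_eqVlt; apply/orP; left; apply/eqP; ring.
  rewrite EFinD !EFinM EFinD; apply: leeD; apply: lee_wpmul2l; rewrite ?lee_fin//.
    apply: le_trans intU _; rewrite lee_fin.
    by apply: ge0_ler_powR; rewrite ?nnegrE ?g_ge0 ?divr_ge0 ?(ltW nu0) ?g_nd.
  apply: leeD.
    by apply: le_trans intT1 _; rewrite lee_fin; exact: half_bound.
  by apply: le_trans intT2 _; rewrite lee_fin; exact: half_bound.
- move=> [f k] w /= [Df kl].
  have [ks|sk] := ltnP k s.
    have ks1 : (k <= s.-1)%N by clear -ks; lia.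
    have /= yT1 := T1P (f, k) w (conj Df ks1).
    apply: (le_trans yT1); rewrite -[leLHS]add0e /W; apply: leeD.
      by rewrite mule_ge0 ?lee_fin.
    rewrite -[leLHS]mul1e; apply: lee_pmul; rewrite ?lee_fin//.
    by rewrite leeDl.
  have /= yT2 := T2P (f, (k - s)%N) w (conj Df (leq_sub2r s kl)).
  have /= yU := UP f w Df.
  rewrite (@big_cat_nat _ _ _ (i + s)) ?leq_addr ?leq_add2l//=.
  rewrite (_ : i + k = i + s + (k - s))%N; last by rewrite -addnA subnKC.
  set a := \sum_(i <= j < i + s) _ in yU *.
  set b := \sum_(i + s <= j < _) _ in yT2 *.
  have ab : `|a + b| `^ nu <= c1 * `|a| `^ nu + c2 * `|b| `^ nu.
    apply: le_trans (powR_add_le _ _ _ _ la01 (ltW nu1) _ _) => //.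
    by apply: ge0_ler_powR; rewrite ?nnegrE ?addr_ge0 ?ler_normD ?(ltW nu0).
  apply: (@le_trans _ _ (c1 * `|a| `^ nu + c2 * `|b| `^ nu)%:E).
    by rewrite lee_fin.
  rewrite EFinD !EFinM; apply: leeD; apply: lee_wpmul2l; rewrite ?lee_fin//.
  by apply: (le_trans yT2); rewrite leeDr.
Qed.

(** * Limits, majorants and Markov's inequality *)

Lemma cvge_fin_near {R : realType} {I : Type} (F : set_system I) {FF : ProperFilter F}
    (f : I -> \bar R) (a : R) :
  f @ F --> a%:E <->
  forall e : R, 0 < e -> \forall x \near F, ((a - e)%:E < f x < (a + e)%:E)%E.
Proof.
split => [/fine_cvgP[ffin /cvgrPdist_lt fa] e e0|H].
  near=> x.
  have fx : f x \is a fin_num by near: x.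
  rewrite -(fineK fx) !lte_fin -ltr_distlC.
  by near: x; exact: fa.
apply/fine_cvgP; split.
  near=> x; have /andP[fx1 fx2] : ((a - 1)%:E < f x < (a + 1)%:E)%E.
    by near: x; exact: H.
  by rewrite fin_real// (lt_trans (ltNyr _) fx1) (lt_trans fx2 (ltry _)).
apply/cvgrPdist_lt => e e0; near=> x.
have /andP[fx1 fx2] : ((a - e)%:E < f x < (a + e)%:E)%E by near: x; exact: H.
have fx : f x \is a fin_num.
  by rewrite fin_real// (lt_trans (ltNyr _) fx1) (lt_trans fx2 (ltry _)).
by move: fx1 fx2; rewrite -(fineK fx) !lte_fin/= ltr_distlC => -> ->.
Unshelve. all: by end_near. Qed.

Lemma limn_esup_lt_near {R : realType} (u : nat -> \bar R) (c : \bar R) :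
  (limn_esup u < c)%E -> \forall n \near \oo, (u n < c)%E.
Proof.
move=> /ereal_inf_lt[_ [V FV <-] supV].
apply: filterS FV => n Vn; apply: le_lt_trans supV.
by apply: ereal_sup_ubound; exists n.
Qed.

Lemma limn_esup_le_near {R : realType} (u : nat -> \bar R) (c : \bar R) :
  (\forall n \near \oo, (u n <= c)%E) -> (limn_esup u <= c)%E.
Proof.
move=> uc; apply: (@le_trans _ _ (ereal_sup (u @` [set n | (u n <= c)%E]))).
  by apply: ereal_inf_lbound; exists [set n | (u n <= c)%E].
by apply: ge_ereal_sup => _ [n /= ? <-].
Qed.

Lemma limn_esup_ge0 {R : realType} (u : nat -> \bar R) :
  (forall n, (0 <= u n)%E) -> (0 <= limn_esup u)%E.
Proof.
move=> u0; apply: le_ereal_inf_tmp => _ [V FV <-].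
have /filter_ex[n Vn] := FV.
by apply: le_trans (u0 n) _; apply: ereal_sup_ubound; exists n.
Qed.

Lemma powR_small {R : realType} (c p eta : R) : 0 <= c -> 0 < p -> 0 < eta ->
  exists2 x0 : R, 0 < x0 & forall x, 0 <= x <= x0 -> c * x `^ p <= eta.
Proof.
move=> c0 p0 eta0.
have c10 : 0 < c + 1 by lra.
have r0 : 0 < eta / (c + 1) by rewrite divr_gt0.
exists ((eta / (c + 1)) `^ p^-1); first exact: powR_gt0.
move=> x /andP[x0 xx].
have xp : x `^ p <= eta / (c + 1).
  rewrite [leRHS](_ : _ = ((eta / (c + 1)) `^ p^-1) `^ p); last first.
    by rewrite -powRrM mulVf ?gt_eqF// (powRr1 (ltW r0)).
  by apply: ge0_ler_powR; rewrite ?nnegrE ?powR_ge0 ?(ltW p0).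
apply: (le_trans (ler_wpM2l c0 xp)).
rewrite mulrA ler_pdivrMr// mulrC ler_pM2l//; lra.
Qed.

Lemma dominated_of_Estar {R : realType} {d} {Omega : measurableType d}
    (P : probability Omega R) {I : Type} (D : set I) (y : I -> Omega -> R) (c : R) :
  0 <= c -> (forall i w, D i -> 0 <= y i w) ->
  (Estar P (fun w => ereal_sup [set (y i w)%:E | i in D]) <= c%:E)%E ->
  dominated P D y c.
Proof.
move=> c0 y0 yc.
(* For empty [D] the supremum is [-oo], so the nonnegativity that [Estar_majorant] asks for
   fails. *)
have [[i0 Di0]|noD] := pselect (exists i, D i); last first.
  exists (cst 0%E); split => //; first by rewrite integral0 lee_fin.
  by move=> i w Di; case: noD; exists i.
have sup0 w : (0 <= ereal_sup [set (y i w)%:E | i in D])%E.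
  apply: (@le_trans _ _ (y i0 w)%:E); first by rewrite lee_fin y0.
  by apply: ereal_sup_ubound; exists i0.
have [U [mU U0 YU intU]] := Estar_majorant _ _ _ sup0 yc.
exists U; split => // i w Di; apply: le_trans (YU w).
by apply: ereal_sup_ubound; exists i.
Qed.

Lemma dominated_le {R : realType} {d} {Omega : measurableType d}
    (P : probability Omega R) {I : Type} (D : set I) (y : I -> Omega -> R) (c c' : R) :
  c <= c' -> dominated P D y c -> dominated P D y c'.
Proof.
move=> cc' [T [mT T0 intT TP]]; exists T; split => //.
by apply: le_trans intT _; rewrite lee_fin.
Qed.

Lemma dominated_bigU {R : realType} {d} {Omega : measurableType d}
    (P : probability Omega R) {I : Type} (D : nat -> set I)
    (y : nat -> I -> Omega -> R) (c : R) (K : nat) : 0 <= c ->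
  (forall b, (b < K)%N -> dominated P (D b) (y b) c) ->
  dominated P [set p : nat * I | (p.1 < K)%N /\ D p.1 p.2] (fun p => y p.1 p.2)
    (K%:R * c).
Proof.
move=> c0; elim: K => [_|K IH H].
  exists (cst 0%E); split => //; first by rewrite integral0 mul0r.
  by move=> [b i] w [].
have [T [mT T0 intT TP]] := IH (fun b bK => H b (ltnW bK)).
have [U [mU U0 intU UP]] := H K (ltnSn K).
exists (T \+ U)%E; split.
- exact: emeasurable_funD.
- by move=> w; rewrite adde_ge0.
- by rewrite ge0_integralD// -natr1 mulrDl mul1r EFinD leeD.
- move=> [b i] w /= [bK Dbi].
  have [bK'|bK'] := ltnP b K.
    by apply: (le_trans (TP (b, i) w (conj bK' Dbi))); rewrite leeDl.
  have bE : b = K by apply/eqP; rewrite eqn_leq bK' -ltnS bK.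
  by subst b; apply: (le_trans (UP i w Dbi)); rewrite leeDr.
Qed.

(** The exceptional set is a level set of the majorant, hence measurable and the same for all
    indices, although the supremum itself may be nonmeasurable. *)
Lemma dominated_markov {R : realType} {d} {Omega : measurableType d}
    (P : probability Omega R) {I : Type} (D : set I) (y : I -> Omega -> R) (c a : R) :
  0 < a -> dominated P D y c ->
  exists B, [/\ measurable B, (P B <= (c / a)%:E)%E &
    forall i w, D i -> ~ B w -> y i w <= a].
Proof.
move=> a0 [T [mT T0 intT TP]].
have absT w : `|T w|%E = T w by rewrite gee0_abs.
exists [set w | (a%:E <= T w)%E]; split.
- by rewrite -[X in measurable X]setTI; exact: emeasurable_fun_c_infty.
- have := @le_integral_comp_abse _ _ _ P setT measurableT T a id
    (@measurable_id _ _ _) (fun r r0 => r0) (fun x y _ _ xy => xy) mT a0.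
  rewrite setTI/=; under eq_integral do rewrite absT.
  rewrite (_ : [set x | _] = [set w | (a%:E <= T w)%E]); last first.
    by apply/funext => w /=; rewrite absT.
  move=> /le_trans/(_ intT) aPc.
  by rewrite (mulrC c) EFinM lee_pdivlMl.
- move=> i w Di /negP; rewrite -ltNge => Ta.
  by rewrite -lee_fin; apply: le_trans (ltW Ta); exact: TP.
Qed.

(** Markov's inequality at level [(e * sqrt n)^nu] turns [x^(nu/2)] into [(x/n)^(nu/2)], the ratio
    that assumptions (3) and (4) control. *)
Lemma scaled_markov {R : realType} {d} {Omega : measurableType d}
    (P : probability Omega R) {I : Type} (D : set I) (u : I -> Omega -> R)
    (nu e c x : R) (n : nat) :
  0 < nu -> 0 < e -> (0 < n)%N -> 0 <= x ->
  dominated P D (fun i w => `|u i w| `^ nu) (c * x `^ (nu / 2)) ->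
  exists B, [/\ measurable B,
    (P B <= (c / e `^ nu * (x / n%:R) `^ (nu / 2))%:E)%E &
    forall i w, D i -> ~ B w -> (Num.sqrt n%:R)^-1 * `|u i w| <= e].
Proof.
move=> nu0 e0 n0 x0 dom.
have nR : 0 < n%:R :> R by rewrite ltr0n.
have s0 : 0 < Num.sqrt n%:R :> R by rewrite sqrtr_gt0.
have es0 : 0 < e * Num.sqrt n%:R by rewrite mulr_gt0.
have [B [mB PB BP]] := dominated_markov _ _ _ _ ((e * Num.sqrt n%:R) `^ nu)
  (powR_gt0 _ es0) dom.
exists B; split => //.
  suff -> : c / e `^ nu * (x / n%:R) `^ (nu / 2) =
    c * x `^ (nu / 2) / (e * Num.sqrt n%:R) `^ nu by [].
  rewrite powRM ?invr_ge0 ?(ltW nR)// powRM ?(ltW e0) ?(ltW s0)//.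
  rewrite -powR12_sqrt ?(ltW nR)// -[in RHS]powRrM.
  rewrite -(powR_inv1 (ltW nR)) -powRrM mulN1r powRN (mulrC 2^-1).
  by rewrite invfM; ring.
move=> i w Di Bw; have := BP i w Di Bw.
move=> le_pow.
have : `|u i w| <= e * Num.sqrt n%:R.
  rewrite leNgt; apply/negP => lt_u.
  have := gt0_ltr_powR nu0 _ _ lt_u; rewrite !nnegrE (ltW es0) normr_ge0.
  by move=> /(_ isT isT); rewrite ltNge le_pow.
by rewrite ler_pdivrMl// mulrC.
Qed.

(** * Increments of the sequential process *)

Lemma Eval_sub {R : realType} {d} {Omega : measurableType d}
    (P : probability Omega R) (Y1 Y2 : Omega -> R) :
  P.-integrable setT (EFin \o Y1) -> P.-integrable setT (EFin \o Y2) ->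
  Eval P (Y1 \- Y2) = Eval P Y1 - Eval P Y2.
Proof.
move=> i1 i2; rewrite /Eval -fineB; [|exact: integrable_fin_num..].
by congr fine; rewrite -integralB.
Qed.

(* Condition (S) says nothing about [g 0], which is a junk value here. *)
Definition zero_at_0 {R : realType} (g : nat -> R) (l : nat) : R :=
  if l == 0%N then 0 else g l.

Section zero_at_0_condS.
Context {R : realType} (al Q : R) (g : nat -> R) (gS : condS al g Q).

Lemma zero_at_0_ge0 l : 0 <= zero_at_0 g l.
Proof.
case: gS => _ _ g0 _ _; rewrite /zero_at_0; case: posnP => // l0; exact: g0.
Qed.

Lemma zero_at_0_nd i j : (i <= j)%N -> zero_at_0 g i <= zero_at_0 g j.
Proof.
move=> ij; have [i0|i0] := posnP i; first by rewrite {1}/zero_at_0 i0 zero_at_0_ge0.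
case: gS => _ _ _ gnd _; rewrite /zero_at_0 !gtn_eqF ?(leq_trans i0)//.
by apply: gnd; rewrite i0.
Qed.

Lemma zero_at_0_split i l : (1 <= i < l)%N ->
  zero_at_0 g i + zero_at_0 g (l - i)%N <= Q * zero_at_0 g l.
Proof.
move=> /andP[i0 il]; case: gS => _ _ _ _ gQ.
have l0 : (0 < l)%N by exact: ltn_trans il.
have li0 : (0 < l - i)%N by rewrite subn_gt0.
by rewrite /zero_at_0 (gtn_eqF i0) (gtn_eqF l0) (gtn_eqF li0); apply: gQ; rewrite i0.
Qed.

End zero_at_0_condS.

Section increments.
Context {R : realType} {d dX : measure_display} {Omega : measurableType d}
  (P : probability Omega R) {X : measurableType dX} (Xa : nat -> nat -> Omega -> X)
  (Fam : set (X -> R)) (Fenv : X -> R) (rho : (X -> R) -> (X -> R) -> R) (nu : R).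
Hypotheses
  (mXa : forall n i, (1 <= i <= n)%N -> measurable_fun setT (Xa i n))
  (mFam : forall f, Fam f -> measurable_fun setT f)
  (FamF : forall f, Fam f -> forall x, `|f x| <= Fenv x)
  (intF : forall n i, (1 <= i <= n)%N ->
     P.-integrable setT (fun w => (Fenv (Xa i n w))%:E))
  (nu2 : 2 < nu).

Let nu0 : 0 < nu. Proof. exact: lt_trans nu2. Qed.

Lemma integrable_Fam n k f : (1 <= k <= n)%N -> Fam f ->
  P.-integrable setT (EFin \o (f \o Xa k n)).
Proof.
move=> kn Ff; apply: le_integrable (intF _ _ kn) => //.
  apply/measurable_EFinP; apply: (measurableT_comp (mFam _ Ff)); exact: mXa.
move=> w _ /=; rewrite lee_fin.
by apply: (le_trans (FamF _ Ff _)); rewrite ler_norm.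
Qed.

Lemma Ssum_sub n j f f' w : (j <= n)%N -> Fam f -> Fam f' ->
  Ssum P Xa n 1 j (f \- f') w = Ssum P Xa n 1 j f w - Ssum P Xa n 1 j f' w.
Proof.
move=> jn Ff Ff'; rewrite /Ssum -sumrB; apply: eq_big_nat => k /andP[k1 kj].
have kn : (1 <= k <= n)%N by rewrite k1 (leq_trans _ jn).
rewrite (_ : (f \- f') \o Xa k n = (f \o Xa k n) \- (f' \o Xa k n))//.
rewrite Eval_sub; [|exact: integrable_Fam..].
by rewrite /=; ring.
Qed.

Let zk n k (f : X -> R) w := f (Xa k n w) - Eval P (f \o Xa k n).

(** The constant is chosen before [D], [g] and [n]. It therefore serves all radii [dl] at once when
    the functions [g(., dl)] share one index [Q]. *)
Lemma maximal_Ssum (Q : R) : 1 <= Q -> Q < 2 `^ ((nu / 2 - 1) / (nu / 2)) ->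
  exists2 A : R, 0 <= A &
  forall (D : set (X -> R)) (g : nat -> R) n, condS (nu / 2) g Q ->
  (forall i j, (1 <= i <= j)%N -> (j <= n)%N ->
     (Estar P (fun w => ereal_sup [set (`|Ssum P Xa n i j f w| `^ nu)%:E | f in D])
      <= ((g (j - i + 1)%N) `^ (nu / 2))%:E)%E) ->
  forall i l, (0 < i)%N -> (i + l <= n.+1)%N ->
    dominated P [set p : (X -> R) * nat | D p.1 /\ (p.2 <= l)%N]
      (fun p w => `|\sum_(i <= k < i + p.2) zk n k p.1 w| `^ nu)
      (A * zero_at_0 g l `^ (nu / 2)).
Proof.
move=> Q1 Q2; have [A A0 HA] := maximal_inequality nu Q nu2 Q1 Q2.
exists A => // D g n gS gE i l i0 il.
apply: (HA _ _ P _ D (zk n) (zero_at_0 g) n) => //.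
- by move=> k; exact: (zero_at_0_ge0 _ _ _ gS).
- by move=> a b; exact: (zero_at_0_nd _ _ _ gS).
- by move=> a b; exact: (zero_at_0_split _ _ _ gS).
- move=> {i0 il}{}i {}l i0 l0 il.
  have il1 : (1 <= i <= (i + l).-1)%N by clear -i0 l0; lia.
  have iln : ((i + l).-1 <= n)%N by clear -il; lia.
  have lE : ((i + l).-1 - i + 1 = l)%N by clear -i0 l0; lia.
  have H := gE i (i + l).-1 il1 iln.
  apply: dominated_of_Estar; [exact: powR_ge0|by move=> *; exact: powR_ge0|].
  rewrite /zero_at_0 gtn_eqF//.
  by move: H; rewrite lE /Ssum prednK// addn_gt0 i0.
Qed.

Lemma truncn_mul_le n (s : R) : 0 <= s <= 1 -> (Num.truncn (n%:R * s) <= n)%N.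
Proof.
move=> /andP[s0 s1]; rewrite -(ler_nat R).
apply: (@le_trans _ _ (n%:R * s)); first by rewrite truncn_le mulr_ge0.
by rewrite ler_piMr.
Qed.

(** At a fixed time the increment is a partial sum over the class [Fdelta], so the maximal
    inequality on the whole range [1..n] handles all times together. *)
Lemma rho_increments (g : nat -> R -> R) :
  (forall n dl i j, 0 < dl -> (1 <= i <= j)%N -> (j <= n)%N ->
     (Estar P (fun w => ereal_sup
        [set ((`|Ssum P Xa n i j f w|) `^ nu)%:E | f in Fdelta Fam rho dl])
      <= ((g (j - i + 1)%N dl) `^ (nu / 2))%:E)%E) ->
  (exists Qg : R, forall dl, 0 < dl -> condS (nu / 2) (fun k => g k dl) Qg) ->
  (fun dl => limn_esup (fun n => (g n dl / n%:R)%:E)) @ 0^'+ --> 0%E ->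
  forall e eta : R, 0 < e -> 0 < eta -> exists2 dl0 : R, 0 < dl0 &
  forall dl, 0 < dl < dl0 -> \forall n \near \oo, exists B,
    [/\ measurable B, (P B <= eta%:E)%E &
     forall s f f' w, 0 <= s <= 1 -> Fam f -> Fam f' -> rho f f' <= dl ->
       ~ B w -> `|Zproc P Xa n s f w - Zproc P Xa n s f' w| <= e].
Proof.
move=> gE [Q gS] glim e eta e0 eta0.
have [Q1 Q2 _ _ _] := gS 1 ltr01.
have [A A0 HA] := maximal_Ssum _ Q1 Q2.
have Ae0 : 0 <= A / e `^ nu by rewrite divr_ge0 ?powR_ge0.
have nu20 : 0 < nu / 2 by rewrite divr_gt0.
(* The bound on the probability drops below [eta] once [g n dl / n] is at most [x0]; assumption (3)
   then gives [dl0]. *)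
have [x0 x00 x0P] := powR_small _ _ _ Ae0 nu20 eta0.
have [dl0 /= dl00 dl0P] := (cvge_fin_near _ _ _).1 glim _ x00.
exists dl0 => // dl /andP[dlgt0 dll].
have /andP[_] : ((0 - x0)%:E < limn_esup (fun n => (g n dl / n%:R)%:E) < (0 + x0)%:E)%E.
  by apply: dl0P => //=; rewrite sub0r normrN gtr0_norm.
rewrite add0r => /limn_esup_lt_near gn; near=> n.
have gnx : g n dl / n%:R < x0 by rewrite -lte_fin; near: n.
have n0 : (0 < n)%N by near: n; exists 1%N.
have n11 : (1 + n <= n.+1)%N by [].
have dom := HA (Fdelta Fam rho dl) (fun k => g k dl) n (gS _ dlgt0)
  (fun i j => gE n dl i j dlgt0) 1%N n isT n11.
have gn0 : 0 <= g n dl by case: (gS _ dlgt0) => _ _ + _ _; apply.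
move: dom; rewrite /zero_at_0 gtn_eqF// => dom.
have [B [mB PB BP]] := scaled_markov P _
  (fun p w => \sum_(1 <= k < 1 + p.2) zk n k p.1 w) _ _ _ _ n nu0 e0 n0 gn0 dom.
exists B; split => //.
  by apply: (le_trans PB); rewrite lee_fin x0P// divr_ge0//= ltW.
move=> s f f' w s01 Ff Ff' ff' Bw.
rewrite /Zproc -mulrBr -Ssum_sub ?truncn_mul_le// normrM ger0_norm ?invr_ge0//.
apply: (BP (f \- f', Num.truncn (n%:R * s)) w) => //=.
by split; [exists f, f'|exact: truncn_mul_le].
Unshelve. all: by end_near. Qed.

(** Two times within [dl] fall into a common block among about [1 / dl] overlapping blocks of length
    about [4 * n * dl]. Each block fails with probability of order [dl^(nu/2)], and [nu > 2] makes
    the total small. *)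
Lemma time_increments (h : nat -> R) :
  (forall n i j, (1 <= i <= j)%N -> (j <= n)%N ->
     (Estar P (fun w => ereal_sup
        [set ((`|Ssum P Xa n i j f w|) `^ nu)%:E | f in Fam])
      <= ((h (j - i + 1)%N) `^ (nu / 2))%:E)%E) ->
  (exists Qh : R, condS (nu / 2) h Qh) ->
  (exists C : R, 0 <= C /\ forall e : R, 0 < e <= 1 ->
     (limn_esup (fun n => (zero_at_0 h (Num.truncn (n%:R * e)) / n%:R)%:E) <= (C * e)%:E)%E) ->
  forall e eta : R, 0 < e -> 0 < eta -> exists2 dl0 : R, 0 < dl0 &
  forall dl, 0 < dl < dl0 -> \forall n \near \oo, exists B,
    [/\ measurable B, (P B <= eta%:E)%E &
     forall s t f w, 0 <= s <= 1 -> 0 <= t <= 1 -> Fam f -> `|s - t| <= dl ->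
       ~ B w -> `|Zproc P Xa n s f w - Zproc P Xa n t f w| <= e].
Proof.
move=> hE [Q hS] [C [C0 hlim]] e eta e0 eta0.
have [Q1 Q2 _ _ _] := hS.
have [A A0 HA] := maximal_Ssum _ Q1 Q2.
have e20 : 0 < e / 2 by rewrite divr_gt0.
have C1 : 0 < (C + 1) * 4 by lra.
(* What remains of the final bound after extracting [dl^(nu/2 - 1)]: [2 / dl] bounds the number of
   blocks, [(C + 1) * (4 * dl)] bounds [h(L) / n], and each endpoint gets [e / 2]. *)
pose c := 2 * A / (e / 2) `^ nu * ((C + 1) * 4) `^ (nu / 2).
have c0 : 0 <= c by rewrite !mulr_ge0 ?invr_ge0 ?powR_ge0.
have nu20 : 0 < nu / 2 - 1 by have := nu2; lra.
have [x0 x00 x0P] := powR_small _ _ _ c0 nu20 eta0.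
exists (Num.min x0 (1 / 4)); first by rewrite lt_min x00/=; lra.
move=> dl /andP[dl0]; rewrite lt_min => /andP[dlx dl4].
have dl401 : 0 < 4 * dl <= 1 by lra.
(* Replacing [C] by [C + 1] makes the inequality strict, so that it holds for all large [n]. *)
have /limn_esup_lt_near hn : (limn_esup (fun n =>
    (zero_at_0 h (Num.truncn (n%:R * (4 * dl))) / n%:R)%:E) < ((C + 1) * (4 * dl))%:E)%E.
  by apply: le_lt_trans (hlim _ dl401) _; rewrite lte_fin ltr_pM2r//; lra.
near=> n.
have n0 : (0 < n)%N by near: n; exists 1%N.
have nR : 0 < n%:R :> R by rewrite ltr0n.
(* This absorbs the rounding errors: [4 * n * dl < L + 1 <= 2 * l + 2] then gives
   [n * dl + 1 <= l]. *)
have ndl2 : 2 <= n%:R * dl.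
  rewrite -ler_pdivrMr//; near: n; exact: nbhs_infty_ger.
have hL : zero_at_0 h (Num.truncn (n%:R * (4 * dl))) / n%:R < (C + 1) * (4 * dl).
  by rewrite -lte_fin; near: n.
set L := Num.truncn (n%:R * (4 * dl)) in hL.
have LP : n%:R * (4 * dl) < L%:R + 1.
  by rewrite natr1; exact: truncnS_gt.
(* Blocks have length [L] but start at every multiple of [l], so consecutive ones overlap by at
   least [l]. *)
pose l := L./2.
have lL : (l + l <= L)%N by clear; rewrite addnn /l; lia.
have Ll : (L <= l + l + 1)%N by clear; rewrite addnn /l; lia.
have LlR : L%:R <= l%:R + l%:R + 1 :> R by rewrite -natrD natr1 ler_nat -addn1.
have lP : n%:R * dl + 1 <= l%:R by lra.
have l0 : (0 < l)%N by rewrite -(ltr_nat R); lra.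
pose K := (n %/ l).+1.
have KP : K%:R <= 2 / dl.
  rewrite ler_pdivlMr// /K -natr1 mulrDl mul1r.
  suff : (n %/ l)%:R * dl <= 1 by lra.
  have : (n %/ l)%:R * l%:R <= n%:R :> R by rewrite -natrM ler_nat leq_trunc_div.
  have ndlR : 0 <= (n %/ l)%:R :> R by [].
  move: (n %/ l)%:R ndlR => m m0 ml.
  have : m * (n%:R * dl) <= m * l%:R by rewrite ler_wpM2l//; lra.
  rewrite mulrCA => H; have := le_trans H ml.
  by rewrite -[leRHS]mulr1 ler_pM2l.
(* The last blocks are cut off at [n], beyond which there are no moment bounds. *)
pose len b := minn L (n - b * l).
have hL0 : 0 <= zero_at_0 h L by exact: (zero_at_0_ge0 _ _ _ hS).
have blk b : (b < K)%N -> dominated P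
    [set p : (X -> R) * nat | Fam p.1 /\ (p.2 <= len b)%N]
    (fun p w => `|\sum_((b * l).+1 <= k < (b * l).+1 + p.2) zk n k p.1 w| `^ nu)
    (A * zero_at_0 h L `^ (nu / 2)).
  move=> bK.
  have bln : (b * l <= n)%N.
    by apply: leq_trans (leq_trunc_div n l); rewrite leq_mul2r -ltnS bK orbT.
  apply: dominated_le (HA Fam h n hS (hE n) (b * l).+1 (len b) _ _) => //; last first.
    by clear -bln; rewrite /len; lia.
  rewrite ler_wpM2l//; apply: ge0_ler_powR.
  - by rewrite divr_ge0// ltW.
  - by rewrite nnegrE; exact: (zero_at_0_ge0 _ _ _ hS).
  - by rewrite nnegrE.
  - by apply: (zero_at_0_nd _ _ _ hS); exact: geq_minl.
have AL0 : 0 <= A * zero_at_0 h L `^ (nu / 2) by rewrite mulr_ge0 ?powR_ge0.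
have := dominated_bigU _ _ _ _ _ AL0 blk; rewrite mulrA => dom.
have [B [mB PB BP]] := scaled_markov P _
  (fun p w => \sum_((p.1 * l).+1 <= k < (p.1 * l).+1 + p.2.2) zk n k p.2.1 w)
  _ _ _ _ n nu0 e20 n0 hL0 dom.
exists B; split => //.
  apply: (le_trans PB); rewrite lee_fin.
  apply: (@le_trans _ _ (c * dl `^ (nu / 2 - 1))); last by rewrite x0P// !ltW.
  have -> : c * dl `^ (nu / 2 - 1) =
      (2 / dl) * A / (e / 2) `^ nu * ((C + 1) * (4 * dl)) `^ (nu / 2).
    rewrite (mulrA (C + 1)) (powRM _ (ltW C1) (ltW dl0)) -(@mulr_powRB1 _ dl (nu / 2)) ?ltW//; last first.
      by have := nu0; lra.
    by rewrite /c; field; rewrite gt_eqF ?powR_gt0// gt_eqF.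
  apply: ler_pM.
  - by rewrite !mulr_ge0 ?invr_ge0 ?powR_ge0.
  - exact: powR_ge0.
  - by rewrite ler_wpM2r ?invr_ge0 ?powR_ge0// ler_wpM2r.
  - apply: ge0_ler_powR; first by have := nu0; lra.
    + by rewrite nnegrE divr_ge0.
    + by rewrite nnegrE; apply: le_trans (ltW hL); rewrite divr_ge0.
    + exact: ltW.
have main s t f w : s <= t -> 0 <= s <= 1 -> 0 <= t <= 1 -> Fam f -> t - s <= dl ->
    ~ B w -> `|Zproc P Xa n t f w - Zproc P Xa n s f w| <= e.
  move=> st s01 t01 Ff tsdl Bw.
  set a := Num.truncn (n%:R * s); set b := Num.truncn (n%:R * t).
  have ab : (a <= b)%N by apply: le_truncn; rewrite ler_wpM2l.
  have an : (a <= n)%N by exact: truncn_mul_le.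
  have bn : (b <= n)%N by exact: truncn_mul_le.
  have bal : (b <= a + l)%N.
    rewrite -ltnS -(ltr_nat R) -natr1 natrD.
    have b1 : b%:R <= n%:R * t by rewrite truncn_le mulr_ge0//; case/andP: t01.
    have a1 : n%:R * s < a%:R + 1 by rewrite natr1; exact: truncnS_gt.
    have : n%:R * (t - s) <= n%:R * dl by rewrite ler_wpM2l.
    by rewrite mulrBr; lra.
  (* The block starting at [q * l] contains both endpoints: [a] is less than [l] past its start and
     [b] at most [l] past [a], while [2 * l <= L]. *)
  pose q := (a %/ l)%N.
  have qK : (q < K)%N by rewrite /q /K ltnS leq_div2r.
  have qa : (q * l <= a)%N by exact: leq_trunc_div.
  have aq : (a < q * l + l)%N by rewrite -mulSnr; exact: ltn_ceil.
  have Z1 j : (q * l <= j)%N -> Ssum P Xa n 1 j f w = Ssum P Xa n 1 (q * l) f w +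
      \sum_((q * l).+1 <= k < (q * l).+1 + (j - q * l)) zk n k f w.
    move=> qj; rewrite /Ssum (@big_cat_nat _ _ _ (q * l).+1)//=.
    by rewrite addSn subnKC.
  have Zb j : (q * l <= j)%N -> (j <= n)%N -> (j <= a + l)%N ->
      (Num.sqrt n%:R)^-1 * `|\sum_((q * l).+1 <= k < (q * l).+1 + (j - q * l)) zk n k f w|
      <= e / 2.
    move=> qj jn jal; apply: (BP (q, (f, j - q * l)%N) w) => //=; split => //; split => //.
    by rewrite /len leq_min; apply/andP; split; [clear -jal aq lL; lia|exact: leq_sub2r].
  have Zbb := Zb b (leq_trans qa ab) bn bal.
  have Zba := Zb a qa an (leq_addr _ _).
  rewrite /Zproc -/a -/b -mulrBr (Z1 b) ?(Z1 a)//; last exact: leq_trans ab.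
  set u := \sum_(_ <= k < _) _ in Zbb *; set v := \sum_(_ <= k < _) _ in Zba *.
  rewrite (_ : _ + u - _ = u - v); last by ring.
  rewrite normrM ger0_norm ?invr_ge0//.
  apply: (@le_trans _ _ ((Num.sqrt n%:R)^-1 * (`|u| + `|v|))).
    by rewrite ler_wpM2l ?invr_ge0// ler_normB.
  by rewrite mulrDr; lra.
move=> s t f w s01 t01 Ff stdl Bw.
have [st|/ltW ts] := leP s t.
  by rewrite distrC main// (le_trans _ stdl)// distrC ler_norm.
by rewrite main// (le_trans _ stdl)// ler_norm.
Unshelve. all: by end_near. Qed.

Lemma measurable_Zproc n s f : 0 <= s <= 1 -> Fam f ->
  measurable_fun setT (Zproc P Xa n s f).
Proof.
move=> s01 Ff; apply: measurable_funM; first exact: measurable_cst.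
rewrite (_ : Ssum P Xa n 1 _ f = (fun w => \sum_(k < Num.truncn (n%:R * s)) zk n k.+1 f w)).
  apply: measurable_sum => k.
  apply: measurable_funB; last exact: measurable_cst.
  apply: (measurableT_comp (mFam _ Ff)); apply: mXa => /=.
  exact: leq_trans (ltn_ord k) (truncn_mul_le n s s01).
by apply/funext => w; rewrite /Ssum big_add1 big_mkord.
Qed.

(** For fixed [w] the envelope bounds every summand, which puts the paths in [linf]. Summing
    absolute values up to [n] removes the dependence on [s]. *)
Lemma Zproc_bounded n w : exists M : R, forall s f, 0 <= s <= 1 -> Fam f ->
  `|Zproc P Xa n s f w| <= M.
Proof.
pose b k := Fenv (Xa k n w) + Eval P (fun w => Fenv (Xa k n w)).
exists ((Num.sqrt n%:R)^-1 * \sum_(1 <= k < n.+1) `|b k|) => s f s01 Ff.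
have sn := truncn_mul_le n s s01.
rewrite /Zproc normrM ger0_norm ?invr_ge0// ler_wpM2l ?invr_ge0//.
rewrite (@big_cat_nat _ _ _ (Num.truncn (n%:R * s)).+1)//=.
rewrite -[leLHS]addr0 lerD//; last exact: sumr_ge0.
apply: le_trans (ler_norm_sum _ _ _) _; apply: ler_sum_nat => k /andP[k1 kn].
have kn' : (1 <= k <= n)%N by rewrite k1/= (leq_trans _ sn).
apply: le_trans (ler_normB _ _) _; apply: le_trans (ler_norm _).
rewrite lerD//; first exact: FamF.
apply: le_trans (le_normr_Rintegral measurableT (integrable_Fam _ _ _ kn' Ff)) _.
apply: le_Rintegral => //; last by move=> v _; exact: FamF.
- exact: (integrable_norm (integrable_Fam _ _ _ kn' Ff)).
- exact: intF.
Qed.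

End increments.

(** * Continuous functionals of finitely many marginals *)

Lemma continuous_row {R : realType} {k : nat} (phi : 'rV[R]_k -> R) :
  (forall (v : 'rV[R]_k) (e : R), 0 < e -> exists2 dl : R, 0 < dl & forall u : 'rV[R]_k,
     (forall j, `|v ord0 j - u ord0 j| < dl) -> `|phi v - phi u| < e) ->
  continuous phi.
Proof.
move=> H v; apply/(@cvgrPdist_lt _ _ _ (nbhs v) (nbhs_filter v)) => e e0.
have [dl dl0 Hdl] := H v e e0.
apply/nbhs_ballP; exists dl => //= u vu; apply: Hdl => j; have [_] := vu; apply.
Qed.

Lemma continuous_rowP {R : realType} {k : nat} (phi : 'rV[R]_k -> R) (v : 'rV[R]_k) (e : R) :
  continuous phi -> 0 < e -> exists2 dl : R, 0 < dl & forall u : 'rV[R]_k,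
     (forall j, `|v ord0 j - u ord0 j| < dl) -> `|phi v - phi u| < e.
Proof.
move=> cphi e0.
have /(@cvgrPdist_lt _ _ _ (nbhs v) (nbhs_filter v))/(_ e e0)/nbhs_ballP[dl /= dl0 Hdl] := cphi v.
exists dl => // u vu; apply: Hdl; split => // i j; rewrite (ord1 i); exact: vu.
Qed.

(* Rounding each coordinate down to the grid of mesh [1/(m+1)] leaves countably
   many values, hence a measurable function, and these converge as [m] grows. *)
Lemma measurable_continuous_row {R : realType} {d} {Om : measurableType d}
    {k : nat} (V : 'I_k -> Om -> R) (phi : 'rV[R]_k -> R) :
  (forall j, measurable_fun setT (V j)) -> continuous phi ->
  measurable_fun setT (fun w => phi (\row_j V j w)).
Proof.
move=> mV cphi.
pose grid (m : nat) (q : {ffun 'I_k -> int}) : 'rV[R]_k :=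
  \row_j ((q j)%:~R / m.+1%:R).
pose rnd (m : nat) w : {ffun 'I_k -> int} :=
  [ffun j => Num.floor (V j w * m.+1%:R)].
apply: (@measurable_fun_cvg _ _ _ _ (fun m w => phi (grid m (rnd m w)))).
  move=> m _ B _; rewrite setTI.
  have -> : (fun w => phi (grid m (rnd m w))) @^-1` B =
      \bigcup_(q : {ffun 'I_k -> int}) [set w | rnd m w = q /\ B (phi (grid m q))].
    apply/seteqP; split => [w Bw|w [q _ [<-]]//].
    by exists (rnd m w).
  apply: countable_bigcupT_measurable; first exact: countableP.
  move=> q; have [Bq|Bq] := pselect (B (phi (grid m q))); last first.
    by rewrite (_ : [set w | _] = set0)//; apply/seteqP; split => // w [].
  rewrite (_ : [set w | _] = \bigcap_(j : 'I_k)
      ((fun w => V j w * m.+1%:R) @^-1` [set x | (q j)%:~R <= x < (q j + 1)%:~R])).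
    apply: fin_bigcap_measurable; first exact: finite_finset.
    move=> j _; rewrite -[X in measurable X]setTI.
    have mVm : measurable_fun setT (fun w => V j w * m.+1%:R).
      by apply: measurable_funM => //; exact: mV.
    apply: mVm => //.
    rewrite (_ : [set x | _] = `[(q j)%:~R, (q j + 1)%:~R[%classic)//.
  apply/seteqP; split => [w [<- _] j _ /=|w Hw].
    by rewrite /rnd ffunE; exact: floor_itv.
  split=> //; apply/ffunP => j; rewrite /rnd ffunE.
  by apply: floor_def; exact: Hw.
move=> w _; apply/cvgrPdist_lt => e e0.
have [dl dl0 Hdl] := continuous_rowP _ (\row_j V j w) _ cphi e0.
near=> m; apply: Hdl => j; rewrite !mxE ffunE.
have m0 : 0 < m.+1%:R :> R by [].
have /andP[f1 f2] := floor_itv (V j w * m.+1%:R).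
rewrite intrD1 in f2.
have -> : V j w - (Num.floor (V j w * m.+1%:R))%:~R / m.+1%:R =
    (V j w * m.+1%:R - (Num.floor (V j w * m.+1%:R))%:~R) / m.+1%:R.
  by rewrite mulrBl mulfK// pnatr_eq0.
rewrite normrM (ger0_norm (_ : 0 <= m.+1%:R^-1)) ?invr_ge0//.
rewrite ger0_norm ?subr_ge0// ltr_pdivrMr//.
apply: (@lt_trans _ _ 1); first by lra.
rewrite -ltr_pdivrMl// mulr1 -natr1 (lt_le_trans (_ : dl^-1 < dl^-1 + 1))//.
  by rewrite ltrDl.
by rewrite lerD2r; near: m; exact: nbhs_infty_ger.
Unshelve. all: by end_near. Qed.

(** The possibly nonmeasurable [a] lies between the integrable [b - u] and [b + u]: the latter is an
    admissible majorant, and every admissible majorant is above the former. *)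
Lemma Estar_between {R : realType} {d} {Omega : measurableType d}
    (P : probability Omega R) (a b u : Omega -> R) :
  P.-integrable setT (EFin \o b) -> P.-integrable setT (EFin \o u) ->
  (forall w, `|a w - b w| <= u w) ->
  ((\int[P]_w b w - \int[P]_w u w)%:E <= Estar P (fun w => (a w)%:E)
     <= (\int[P]_w b w + \int[P]_w u w)%:E)%E.
Proof.
move=> ib iu abu.
have iD : P.-integrable setT (EFin \o (b \+ u)) by exact: (integrableD measurableT ib iu).
have iB : P.-integrable setT (EFin \o (b \- u)) by exact: (integrableB measurableT ib iu).
have finE (f : Omega -> R) : P.-integrable setT (EFin \o f) ->
    (\int[P]_w (f w)%:E)%E = (\int[P]_w f w)%:E.
  by move=> fi; rewrite fineK//; exact: integrable_fin_num.
apply/andP; split.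
  apply: le_ereal_inf_tmp => _ [U [mU [aU _]] <-].
  rewrite -RintegralB// -finE//.
  have LU w : ((b w - u w)%:E <= U w)%E.
    apply: le_trans (aU w); rewrite lee_fin.
    by have := abu w; rewrite ler_norml => /andP[]; lra.
  (* The majorant [U] may have an infinite integral, so positive and negative parts are compared
     separately. *)
  rewrite integralE [in leRHS]integralE; apply: leeB.
    apply: ge0_le_integral => //.
    - by apply: measurable_funepos; exact: measurable_int iB.
    - exact: measurable_funepos.
    - by move=> w _; apply: (@funepos_le _ _ setT) => [? _|]; [exact: LU|rewrite inE].
  apply: ge0_le_integral => //.
  - exact: measurable_funeneg.
  - by apply: measurable_funeneg; exact: measurable_int iB.
  - by move=> w _; apply: (@funeneg_le _ _ setT) => [? _|]; [exact: LU|rewrite inE].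
apply: ereal_inf_lbound; exists (fun w => (b w + u w)%:E); last first.
  by rewrite -RintegralD// finE.
split; first exact: measurable_int iD.
split => [w|].
  by rewrite lee_fin; have := abu w; rewrite ler_norml => /andP[]; lra.
left; have /integrableP[_] := iD; apply: le_lt_trans.
apply: ge0_le_integral => //.
- by apply: measurable_funepos; exact: measurable_int iD.
- by apply: measurableT_comp => //; exact: measurable_int iD.
- move=> w _ /=; rewrite funeposE ge_max/= lee_fin ler_norm/=.
  by rewrite lee_fin normr_ge0.
Qed.

Lemma bounded_measurable_integrable {R : realType} {d} {Omega : measurableType d}
    (P : probability Omega R) (f : Omega -> R) (M : R) :
  measurable_fun setT f -> (forall w, `|f w| <= M) ->
  P.-integrable setT (EFin \o f).
Proof.
move=> mf fM; apply: measurable_bounded_integrable => //.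
  by rewrite (le_lt_trans (probability_le1 P _)) ?ltry.
exists M; split; first exact: num_real.
by move=> x Mx w _; apply: le_trans (fM w) _; exact: ltW.
Qed.

Lemma Rintegral_indic {R : realType} {d} {Omega : measurableType d}
    (P : probability Omega R) (B : set Omega) : measurable B ->
  \int[P]_w \1_B w = fine (P B).
Proof. by move=> mB; rewrite /Rintegral integral_indic// setIT. Qed.

Lemma indic_integrable {R : realType} {d} {Omega : measurableType d}
    (P : probability Omega R) (B : set Omega) : measurable B ->
  P.-integrable setT (EFin \o (\1_B : Omega -> R)).
Proof.
move=> mB; apply: (bounded_measurable_integrable _ _ 1) => //.
by move=> w; rewrite indicE; case: (_ \in _); rewrite ?normr1 ?normr0.
Qed.

Lemma Rintegral_prob_cst {R : realType} {d} {Omega : measurableType d}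
    (P : probability Omega R) (c : R) : \int[P]_w (cst c w) = c.
Proof.
rewrite Rintegral_cst//; have := probability_setT P => /= ->.
by rewrite mulr1.
Qed.

(** * The sup-norm topology *)

Definition unif_close {R : realType} {T : Type} (x y : T -> R) (e : R) : Prop :=
  forall t, `|x t - y t| <= e.

Section linf_topology.
Context {R : realType} {T : Type}.
Implicit Types (x y z : T -> R) (e : R) (U K : set (T -> R)).

Lemma unif_closeC x y e : unif_close x y e -> unif_close y x e.
Proof. by move=> xy t; rewrite distrC. Qed.

Lemma unif_close_trans x y z e e' : unif_close x y e -> unif_close y z e' -> unif_close x z (e + e').
Proof.
move=> xy yz t; apply: le_trans (ler_distD (y t) _ _) _.
by rewrite lerD.
Qed.

Lemma unif_close_le x y e e' : e <= e' -> unif_close x y e -> unif_close x y e'.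
Proof. by move=> ee xy t; exact: le_trans ee. Qed.

Lemma supdist_unif_close x y e : (supdist x y < e%:E)%E -> unif_close x y e.
Proof.
move=> xy t; rewrite -lee_fin; apply: le_trans (ltW xy).
by apply: ereal_sup_ubound; exists t.
Qed.

Lemma unif_close_supdist x y e e' : e < e' -> unif_close x y e -> (supdist x y < e'%:E)%E.
Proof.
move=> ee xy; apply: (@le_lt_trans _ _ e%:E); last by rewrite lte_fin.
by apply: ge_ereal_sup => _ [t _ <-]; rewrite lee_fin.
Qed.

Lemma linf_open_unif_close U : U `<=` linf ->
  (forall x, U x -> exists2 e, 0 < e & forall y, linf y -> unif_close x y e -> U y) ->
  linf_open U.
Proof.
move=> Ul UP; split => // x Ux; have [e e0 He] := UP x Ux.
by exists e => // y yl /supdist_unif_close; exact: He.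
Qed.

Lemma bcont_unif_close (h : (T -> R) -> R) x e : linf_bcont h -> linf x -> 0 < e ->
  exists2 dl : R, 0 < dl & forall y, linf y -> unif_close x y dl -> `|h x - h y| < e.
Proof.
move=> [_ hc] xl e0; have [dl dl0 Hdl] := hc x xl e e0.
exists (dl / 2); first by rewrite divr_gt0.
move=> y yl xy; apply: Hdl => //; apply: unif_close_supdist xy; lra.
Qed.

Lemma linf_comp {S : Type} (x : T -> R) (p : S -> T) : linf x -> linf (fun s => x (p s)).
Proof. by move=> [M xM]; exists M. Qed.

(** The subcover is a finite set of open sets; induction on it recovers finitely many indices. The
    set [G] is kept apart because it carries no index. *)
Lemma linf_compact_cover {I : Type} K (G : set (T -> R)) (O : I -> set (T -> R)) :
  linf_compact K -> linf_open G -> (forall i, linf_open (O i)) ->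
  (forall x, K x -> G x \/ exists i, O i x) ->
  exists (n : nat) (p : 'I_n -> I), forall x, K x -> G x \/ exists j, O (p j) x.
Proof.
move=> [Kl Kc] oG oO KO.
have [D /finite_seqP[s ->] [sC Ks]] : exists2 D : set (set (T -> R)), finite_set D &
    D `<=` [set V | V = G \/ exists i, V = O i] /\ K `<=` \bigcup_(U in D) U.
  apply: Kc => [U [->|[i ->]]//|x /KO[Gx|[i Oix]]].
    by exists G => //; left.
  by exists (O i) => //; right; exists i.
have [n [p pP]] : exists n (p : 'I_n -> I), forall V, V \in s -> forall x, V x ->
    G x \/ exists j, O (p j) x.
  elim: s sC {Ks} => [|V s IH] sC.
    have p0 : 'I_0 -> I by case.
    by exists 0%N, p0.
  have [W Ws|n [p pP]] := IH; first by apply: sC; rewrite /= inE Ws orbT.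
  have /= := sC V; rewrite inE eqxx => /(_ isT)[VG|[i Vi]].
    exists n, p => W; rewrite inE => /orP[/eqP->|Ws] x; last exact: pP.
    by rewrite VG; left.
  exists n.+1, (fun j => oapp p i (unlift ord0 j)) => W.
  rewrite inE => /orP[/eqP->|Ws] x Wx.
    by right; exists ord0; rewrite unlift_none/= -Vi.
  have [Gx|[j Oj]] := pP W Ws x Wx; first by left.
  by right; exists (lift ord0 j); rewrite liftK.
exists n, p => x Kx; have [V Vs Vx] := Ks x Kx; exact: pP Vx.
Qed.

Lemma linf_open_set0 : linf_open (@set0 (T -> R)).
Proof. by split. Qed.

Lemma linf_open_far x e : linf x -> linf_open [set y | linf y /\ exists2 e', e < e' &
  exists t, e' < `|x t - y t|].
Proof.
move=> xl; apply: linf_open_unif_close => [y []//|y [yl [e' ee' [t xyt]]]].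
exists ((`|x t - y t| - e') / 2); first by rewrite divr_gt0// subr_gt0.
move=> z zl yz; split => //; exists e' => //; exists t.
have := yz t; have := ler_distD (z t) (x t) (y t); rewrite (distrC (z t)).
by lra.
Qed.

(** The Hausdorff argument: complements of balls of radius [1 / (m + 1)] about a point outside [K]
    cover [K], and finitely many suffice. *)
Lemma linf_compact_closed K : linf_compact K -> linf_open (linf `\` K).
Proof.
move=> cK; have [Kl _] := cK.
apply: linf_open_unif_close => [x []//|x [xl Kx]].
have far y : K y -> set0 y \/ exists m : nat, linf y /\
    exists2 e', (m.+1%:R^-1 : R) < e' & exists t, e' < `|x t - y t|.
  move=> Ky; right.
  have [t xyt] : exists t, x t != y t.
    apply: contrapT => H; apply: Kx; suff -> : x = y by [].
    by apply/funext => t; apply/eqP/negPn/negP => xyt; apply: H; exists t.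
  have d0 : 0 < `|x t - y t| by rewrite normr_gt0 subr_eq0.
  exists (Num.truncn (`|x t - y t| / 2)^-1); split; first exact: Kl.
  exists (`|x t - y t| / 2); last by exists t; lra.
  by rewrite invf_plt ?posrE ?divr_gt0//; exact: truncnS_gt.
have [n [p pP]] := linf_compact_cover K set0
  (fun m : nat => [set y | linf y /\ exists2 e', (m.+1%:R^-1 : R) < e' &
    exists t, e' < `|x t - y t|]) cK linf_open_set0 (fun m => linf_open_far _ _ xl) far.
(* The sum exceeds every [p j], so this radius is below all the finitely many ones. *)
exists ((\sum_(j < n) (p j).+1)%N.+1%:R^-1); first by rewrite invr_gt0.
move=> y yl xy; split => // Ky; have [//|[j [_ [e' e'1 [t]]]]] := pP y Ky.
apply/negP; rewrite -leNgt (le_trans (xy t))// (le_trans _ (ltW e'1))//.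
rewrite lef_pV2 ?posrE// ler_nat ltnW// ltnS (bigD1 j)//= leq_addr//.
Qed.

End linf_topology.

(** * Oscillation radius of a continuous functional *)

Definition osc_le {R : realType} {T : Type} (h : (T -> R) -> R) (e : R)
    (x : T -> R) (r : R) : Prop :=
  forall y z, linf y -> linf z -> unif_close x y r -> unif_close x z r -> `|h y - h z| <= e.

(** The cap at 1 keeps the set bounded, so that [sup] is a genuine supremum even for constant
    [h]. *)
Definition osc_radius {R : realType} {T : Type} (h : (T -> R) -> R) (e : R)
    (x : T -> R) : R :=
  sup [set r | 0 <= r <= 1 /\ osc_le h e x r].

Section osc_radius.
Context {R : realType} {T : Type} (h : (T -> R) -> R) (e : R).
Hypotheses (hc : linf_bcont h) (e0 : 0 < e).
Implicit Types x y : T -> R.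

Let S x := [set r : R | 0 <= r <= 1 /\ osc_le h e x r].

Lemma osc_radius_pos_mem x : linf x -> exists2 r, 0 < r & S x r.
Proof.
move=> xl; have e20 : 0 < e / 2 by rewrite divr_gt0.
have [dl dl0 Hdl] := bcont_unif_close h x (e / 2) hc xl e20.
exists (Num.min dl 1); first by rewrite lt_min dl0 ltr01.
split; first by rewrite le_min (ltW dl0) ler01 ge_min lexx orbT.
move=> y z yl zl xy xz.
have cl u : unif_close x u (Num.min dl 1) -> unif_close x u dl.
  by apply: unif_close_le; rewrite ge_min lexx.
have := Hdl y yl (cl _ xy); have := Hdl z zl (cl _ xz).
have := ler_distD (h x) (h y) (h z); rewrite (distrC (h y) (h x)); lra.
Qed.

Lemma osc_radius_has_sup x : linf x -> has_sup (S x).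
Proof.
move=> xl; split; last by exists 1 => r [/andP[]].
by have [r _ Sr] := osc_radius_pos_mem x xl; exists r.
Qed.

Lemma osc_radius_gt0 x : linf x -> 0 < osc_radius h e x.
Proof.
move=> xl; have [r r0 Sr] := osc_radius_pos_mem x xl.
apply: (lt_le_trans r0); apply: ub_le_sup => //.
by have [] := osc_radius_has_sup x xl.
Qed.

Lemma osc_radiusP x r y z : linf x -> linf y -> linf z -> r < osc_radius h e x ->
  unif_close x y r -> unif_close x z r -> `|h y - h z| <= e.
Proof.
move=> xl yl zl rx xy xz.
have d0 : 0 < osc_radius h e x - r by rewrite subr_gt0.
have [r' [_ Sr'] rr'] := sup_adherent d0 (osc_radius_has_sup x xl).
rewrite opprB addrCA subrr addr0 in rr'.
by apply: Sr' => //; apply: unif_close_le (ltW rr') _.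
Qed.

(** The ball of radius [r - c] about [y] lies in the ball of radius [r] about [x]. *)
Lemma osc_radius_lip x y c : linf x -> linf y -> 0 <= c -> unif_close x y c ->
  osc_radius h e x - c <= osc_radius h e y.
Proof.
move=> xl yl c0 xy; apply/ler_addgt0Pr => d d0.
have [r [r01 Sr] rx] := sup_adherent d0 (osc_radius_has_sup x xl).
have {}rx : osc_radius h e x - d < r by [].
have [rc|cr] := ltP r c.
  by have := osc_radius_gt0 _ yl; lra.
suff : r - c <= osc_radius h e y by lra.
apply: ub_le_sup; first by have [] := osc_radius_has_sup y yl.
split; first by move: r01 cr c0; lra.
have tr u : unif_close y u (r - c) -> unif_close x u r.
  by move=> yu; rewrite -[r](subrK c) addrC; exact: unif_close_trans yu.
by move=> u v ul vl yu yv; apply: Sr => //; exact: tr.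
Qed.

Lemma osc_radius_dist x y c : linf x -> linf y -> 0 <= c -> unif_close x y c ->
  `|osc_radius h e x - osc_radius h e y| <= c.
Proof.
move=> xl yl c0 xy; rewrite ler_distl.
have := osc_radius_lip _ _ _ xl yl c0 xy.
have := osc_radius_lip _ _ _ yl xl c0 (unif_closeC _ _ _ xy).
by move=> ? ?; apply/andP; split; lra.
Qed.

End osc_radius.

(** Boundedness is dropped from [linf_bcont] so that coordinate evaluations are covered too. *)
Definition linf_cont {R : realType} {T : Type} (f : (T -> R) -> R) : Prop :=
  forall x, linf x -> forall e : R, 0 < e -> exists2 dl : R, 0 < dl &
    forall y, linf y -> unif_close x y dl -> `|f x - f y| < e.

(** A path factoring through [idx] takes finitely many values, so coordinatewise closeness is
    uniform closeness. This makes functionals of projected paths accessible to [fidi_conv]. *)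
Lemma continuous_row_comp {R : realType} {T : Type} {k : nat}
    (f : (T -> R) -> R) (idx : T -> 'I_k) :
  linf_cont f -> continuous (fun v : 'rV[R]_k => f (fun t => v ord0 (idx t))).
Proof.
move=> fc; apply: continuous_row => v e e0.
have vl (u : 'rV[R]_k) : linf (fun t => u ord0 (idx t)).
  exists (\sum_j `|u ord0 j|) => t.
  by rewrite (bigD1 (idx t))//= lerDl sumr_ge0.
have [dl dl0 Hdl] := fc _ (vl v) e e0.
exists dl => // u vu; apply: Hdl; first exact: vl.
by move=> t; exact: ltW.
Qed.

Lemma linf_cont_measurable {R : realType} {T : Type} {d} {Om : measurableType d}
    (Z : Om -> T -> R) (f : (T -> R) -> R) :
  borel_linf Z -> linf_cont f -> measurable_fun setT (fun w => f (Z w)).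
Proof.
move=> [Zl mZ] fc; apply: measurability (RGenOInfty.measurableE R) _.
move=> _ [_ [c ->] <-]; rewrite setTI.
have -> : (fun w => f (Z w)) @^-1` `]c, +oo[%classic =
    Z @^-1` [set x | linf x /\ c < f x].
  apply/seteqP; split => w /=; rewrite in_itv/= andbT; last by case.
  by split.
apply: mZ; apply: sub_sigma_algebra.
apply: linf_open_unif_close => [x []//|x [xl cx]].
have d0 : 0 < f x - c by rewrite subr_gt0.
have [dl dl0 Hdl] := fc x xl _ d0.
exists dl => // y yl xy; split => //.
have := Hdl y yl xy; rewrite ltr_distlC => /andP[+ _].
by rewrite opprB addrCA subrr addr0.
Qed.

Lemma linf_bcont_cont {R : realType} {T : Type} (h : (T -> R) -> R) :
  linf_bcont h -> linf_cont h.
Proof. by move=> hc x xl e e0; exact: bcont_unif_close. Qed.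

Lemma linf_cont_osc_radius {R : realType} {T : Type} (h : (T -> R) -> R) (e : R) :
  linf_bcont h -> 0 < e -> linf_cont (osc_radius h e).
Proof.
move=> hc e0 x xl eps eps0; exists (eps / 2); first by rewrite divr_gt0.
move=> y yl xy; apply: (@le_lt_trans _ _ (eps / 2)).
  by apply: osc_radius_dist => //; rewrite divr_ge0// ltW.
by rewrite ltr_pdivrMr// ltr_pMr// ltr1n.
Qed.

Lemma linf_cont_eval {R : realType} {T : Type} (t : T) : linf_cont (fun x : T -> R => x t).
Proof.
move=> x xl e e0; exists (e / 2); first by rewrite divr_gt0.
move=> y _ /(_ t) xy; apply: (le_lt_trans xy).
by rewrite ltr_pdivrMr// ltr_pMr// ltr1n.
Qed.

(** * Weak convergence from finite-valued approximations *)

Lemma truncated_dist {R : realFieldType} (a b dl : R) :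
  `|a - b| <= dl -> `|Num.max 0 a - Num.max 0 b| <= dl /\ `|Num.min 1 a - Num.min 1 b| <= dl.
Proof.
rewrite !ler_norml /Num.max /Num.min => /andP[H1 H2].
case: (ltP 0 a) => a0; case: (ltP 0 b) => b0; case: (ltP 1 a) => a1;
  case: (ltP 1 b) => b1; split; apply/andP; split; lra.
Qed.

Section weak_convergence.
Context {R : realType} {T : Type} {d d' : measure_display}
  {Om : measurableType d} {Om' : measurableType d'}
  (P : probability Om R) (Zn : nat -> Om -> T -> R)
  (P' : probability Om' R) (Z : Om' -> T -> R).
Hypotheses (Znl : forall n w, linf (Zn n w))
  (mZn : forall n t, measurable_fun setT (fun w => Zn n w t))
  (bZ : borel_linf Z) (tZ : tight P' Z) (fZ : fidi_conv P Zn P' Z).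

Let mZ t : measurable_fun setT (fun w => Z w t).
Proof. exact: linf_cont_measurable bZ (linf_cont_eval t). Qed.

Let Zl w : linf (Z w). Proof. by case: bZ. Qed.

Lemma fidi_Rintegral (k : nat) (p : 'I_k -> T) (phi : 'rV[R]_k -> R) (M : R) :
  continuous phi -> (forall v, `|phi v| <= M) ->
  (fun n => \int[P]_w phi (\row_j Zn n w (p j))) @ \oo -->
    \int[P']_w phi (\row_j Z w (p j)).
Proof.
move=> cphi phiM; apply: fine_cvg.
have iZ : P'.-integrable setT (EFin \o (fun w => phi (\row_j Z w (p j)))).
  apply: bounded_measurable_integrable => //.
  exact: (measurable_continuous_row (fun j w => Z w (p j))).
rewrite /Rintegral fineK; last exact: integrable_fin_num.
by apply: fZ => //; exists M.
Qed.

(** Paths at most [2 * e] from their projection lie in the open set [G]; any other path is in some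
    open [O t]. On a compact set carrying [Z] up to [eta'], finitely many [O t] suffice, and the
    marginals bound their union by [eta]. *)
Lemma approx_limit (k : nat) (p : 'I_k -> T) (idx : T -> 'I_k) (e eta eta' : R) :
  0 < e -> 0 < eta -> 0 < eta' ->
  (\forall n \near \oo, exists B, [/\ measurable B, (P B <= eta%:E)%E &
     forall w t, ~ B w -> `|Zn n w t - Zn n w (p (idx t))| <= e]) ->
  exists B', [/\ measurable B', (P' B' <= (eta + eta')%:E)%E &
     forall w, ~ B' w -> unif_close (Z w) (fun t => Z w (p (idx t))) (3 * e)].
Proof.
move=> e0 eta0 eta'0 Hn.
have [K [cK PK]] := tZ eta' eta'0.
pose pr (x : T -> R) t := x (p (idx t)).
pose G := [set x : T -> R | linf x /\ exists2 c, c < 3 * e & unif_close x (pr x) c].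
pose O t := [set x : T -> R | linf x /\ 2 * e < `|x t - pr x t|].
have oG : linf_open G.
  apply: linf_open_unif_close => [x []//|x [xl [c ce xc]]].
  (* Moving a path by [r] moves its projection by at most [r] too, so [c] grows by [2 * r]; a third
     of the slack is small enough. *)
  exists ((3 * e - c) / 3); first by lra.
  move=> y yl xy; split => //; exists (c + 2 * ((3 * e - c) / 3)); first by lra.
  apply: (@unif_close_le _ _ _ _ ((3 * e - c) / 3 + c + (3 * e - c) / 3)); first by lra.
  apply: (unif_close_trans _ (pr x)); last by move=> t; exact: xy.
  by apply: unif_close_trans xc; exact: unif_closeC.
have oO t : linf_open (O t).
  apply: linf_open_unif_close => [x []//|x [xl xe]].
  exists ((`|x t - pr x t| - 2 * e) / 3); first by rewrite divr_gt0// subr_gt0.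
  move=> y yl xy; split => //.
  have := xy t; have := xy (p (idx t)).
  have := ler_distD (y t) (x t) (pr x t).
  have := ler_distD (pr y t) (y t) (pr x t).
  rewrite [`|pr y t - pr x t|]distrC /pr; lra.
have GO x : K x -> G x \/ exists t, O t x.
  move=> Kx; have xl : linf x by case: cK => + _; apply.
  have [Gx|nGx] := pselect (G x); [by left|right].
  apply: contrapT => nO; apply: nGx; split => //; exists (2 * e); first by lra.
  move=> t; rewrite leNgt; apply/negP => xt; apply: nO; by exists t.
have [m [q qP]] := linf_compact_cover K G O cK oG oO GO.
(* The first [m] coordinates are the points of the subcover, the last [m] their projections. *)
pose pts (j : 'I_(m + m)) : T :=
  match fintype.split j with inl a => q a | inr a => p (idx (q a)) end.
pose term (v : 'rV[R]_(m + m)) a :=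
  Num.max 0 (`|v ord0 (lshift m a) - v ord0 (rshift m a)| / e - 1).
(* A continuous surrogate for the indicator of the union: 1 once some pair is [2 * e] apart, 0 while
   all pairs are within [e]. *)
pose phi (v : 'rV[R]_(m + m)) := Num.min 1 (\sum_(a < m) term v a).
have term0 v a : 0 <= term v a by rewrite /term le_max lexx.
have phi0 v : 0 <= phi v by rewrite /phi le_min ler01 sumr_ge0.
have phi1 v : phi v <= 1 by rewrite /phi ge_min lexx.
have phiM v : `|phi v| <= 1 by rewrite ger0_norm.
have cphi : continuous phi.
  apply: continuous_row => v eps eps0.
  have m10 : 0 < m.+1%:R :> R by [].
  (* Two coordinates move per term, so each term changes by at most [eps / (m + 1)]; using [m + 1]
     makes the total strictly less than [eps] and allows [m = 0]. *)
  pose dl := eps * e / (2 * m.+1%:R).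
  have dl0 : 0 < dl by rewrite divr_gt0 ?mulr_gt0.
  exists dl => // u vu.
  apply: (@le_lt_trans _ _ (m%:R * (eps / m.+1%:R))); last first.
    by rewrite mulrCA gtr_pMr// ltr_pdivrMr// mul1r ltr_nat.
  apply: (truncated_dist _ _ _ _).2.
  rewrite -sumrB; apply: (le_trans (ler_norm_sum _ _ _)).
  apply: (@le_trans _ _ (\sum_(a < m) (eps / m.+1%:R))); last first.
    by rewrite sumr_const card_ord mulr_natl.
  apply: ler_sum => a _; apply: (truncated_dist _ _ _ _).1.
  rewrite opprB addrA subrK -mulrBl normrM (ger0_norm (_ : 0 <= e^-1)) ?invr_ge0 ?(ltW e0)//.
  rewrite ler_pdivrMr//.
  have := vu (lshift m a); have := vu (rshift m a).
  set x1 := v _ _; set x2 := u _ _; set y1 := v _ _; set y2 := u _ _ => H1 H2.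
  have -> : eps / m.+1%:R * e = dl + dl.
    by rewrite /dl; field; rewrite addrC natr1.
  apply: le_trans (ler_dist_dist _ _) _.
  rewrite (_ : y1 - x1 - (y2 - x2) = (y1 - y2) - (x1 - x2)); last by ring.
  by apply: le_trans (ler_normB _ _) _; rewrite lerD// ltW.
have rowE (x : T -> R) (a : 'I_m) : ((\row_j x (pts j)) ord0 (lshift m a) = x (q a)) *
    ((\row_j x (pts j)) ord0 (rshift m a) = pr x (q a)).
  by rewrite !mxE /pts (unsplitK (inl a)) (unsplitK (inr a)).
pose V := \bigcup_(a : 'I_m) (Z @^-1` O (q a)).
have mO t : measurable (Z @^-1` O t).
  by apply: bZ.2; apply: sub_sigma_algebra; exact: oO.
have mV : measurable V by apply: fin_bigcup_measurable => //; exact: finite_finset.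
have mphi n : measurable_fun setT (fun w => phi (\row_j Zn n w (pts j))).
  exact: (measurable_continuous_row (fun j w => Zn n w (pts j))).
have mphiZ : measurable_fun setT (fun w => phi (\row_j Z w (pts j))).
  exact: (measurable_continuous_row (fun j w => Z w (pts j))).
have PV : fine (P' V) <= eta.
  apply: (@le_trans _ _ (\int[P']_w phi (\row_j Z w (pts j)))).
    rewrite -Rintegral_indic//; apply: le_Rintegral => //.
    - exact: indic_integrable.
    - exact: bounded_measurable_integrable mphiZ _.
    move=> w _; rewrite indicE; have [/set_mem[a _ [_ Oa]]|_] := boolP (w \in V); last exact: phi0.
    rewrite /= /phi le_min lexx/= (bigD1 a)//=.
    apply: (@le_trans _ _ (term (\row_j Z w (pts j)) a)); last by rewrite lerDl sumr_ge0.
    rewrite /term !rowE le_max; apply/orP; right.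
    by rewrite lerBrDr ler_pdivlMr// ltW// (_ : 1 + 1 = 2).
  apply: (cvgr_to_le (fidi_Rintegral _ pts phi 1 cphi phiM)).
  apply: filterS Hn => n [B [mB PB BP]].
  apply: (@le_trans _ _ (fine (P B))); last first.
    by rewrite -lee_fin fineK ?fin_num_measure.
  rewrite -Rintegral_indic//; apply: le_Rintegral => //.
  - exact: bounded_measurable_integrable (mphi n) _.
  - exact: indic_integrable.
  move=> w _; rewrite indicE; have [_|/negP nB] := boolP (w \in B); first exact: phi1.
  have Bw : ~ B w by move=> Bw; apply: nB; exact: mem_set.
  rewrite /phi big1 ?ge_min ?lexx ?orbT// => a _.
  rewrite /term !rowE; apply/max_idPl.
  by rewrite subr_le0 ler_pdivrMr// mul1r; exact: BP.
have mKc : measurable (Z @^-1` (linf `\` K)).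
  by apply: bZ.2; apply: sub_sigma_algebra; exact: linf_compact_closed.
have KcE : Z @^-1` (linf `\` K) = ~` (Z @^-1` K).
  by apply/seteqP; split => w /=; [case|split].
have mK : measurable (Z @^-1` K) by rewrite -[_ @^-1` K]setCK -KcE; exact: measurableC.
exists (V `|` Z @^-1` (linf `\` K)); split.
- exact: measurableU.
- apply: le_trans (measureU2 _ mV mKc) _; rewrite EFinD; apply: leeD.
    by move: PV; rewrite -lee_fin fineK ?fin_num_measure.
  rewrite KcE; have := probability_setC P' mK => /= ->.
  by rewrite leeBlDr ?fin_num_measure// addeC -leeBlDr.
- move=> w /not_orP[nV nK].
  have Kw : K (Z w) by apply: contrapT => nKw; apply: nK.
  have [[_ [c ce]]|[a Oa]] := qP _ Kw; first exact: unif_close_le (ltW ce).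
  by exfalso; apply: nV; exists a.
Qed.

(** The radius is positive at every path, so the events that it is at most [1 / (m + 1)] decrease to
    the empty set; continuity from above concludes. *)
Lemma osc_radius_small (h : (T -> R) -> R) (e eta : R) :
  linf_bcont h -> 0 < e -> 0 < eta -> exists2 dl : R, 0 < dl &
  exists A, [/\ measurable A, (P' A <= eta%:E)%E &
    forall w, ~ A w -> dl < osc_radius h e (Z w)].
Proof.
move=> hc e0 eta0.
have mr : measurable_fun setT (fun w => osc_radius h e (Z w)).
  exact: linf_cont_measurable bZ (linf_cont_osc_radius _ _ hc e0).
pose A (m : nat) := [set w | osc_radius h e (Z w) <= m.+1%:R^-1].
have mA m : measurable (A m).
  rewrite -[A m]setTI (_ : A m = (fun w => osc_radius h e (Z w)) @^-1` `]-oo, m.+1%:R^-1]).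
    exact: mr.
  by apply/seteqP; split => w /=; rewrite in_itv.
have A0 : \bigcap_m A m = set0.
  apply/seteqP; split => // w Aw.
  have r0 := osc_radius_gt0 h e hc e0 _ (Zl w).
  have := Aw (Num.truncn (osc_radius h e (Z w))^-1) I; rewrite /A/= leNgt => /negP; apply.
  by rewrite invf_plt ?posrE//; exact: truncnS_gt.
have Anon : {homo A : n m / (n <= m)%N >-> (m <= n)%O}.
  move=> n m nm; apply/subsetPset => w; rewrite /A/= => /le_trans; apply.
  by rewrite lef_pV2 ?posrE// ler_nat ltnS.
have finA0 : (P' (A 0%N) < +oo)%E by rewrite (le_lt_trans (probability_le1 P' _)) ?ltry.
have mcap : measurable (\bigcap_m A m) by rewrite A0.
have := nonincreasing_cvg_mu finA0 mA mcap Anon.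
rewrite A0 measure0 => /(cvge_fin_near _ _ 0).1/(_ eta eta0)[m _ /(_ m (leqnn m))/=].
rewrite sub0r add0r => /andP[_ PAm].
exists (m.+1%:R^-1); first by rewrite invr_gt0.
exists (A m); split; [exact: mA|exact: ltW PAm|].
by move=> w /negP; rewrite -ltNge.
Qed.

(** The chain is [h Zn], [h (pr Zn)], [h (pr Z)], [h Z]: the middle step is convergence of
    marginals, the outer ones cost [e] plus [2 * M] on exceptional events. *)
Theorem weak_conv_of_approx :
  (forall e eta : R, 0 < e -> 0 < eta ->
     exists (k : nat) (p : 'I_k -> T) (idx : T -> 'I_k),
     \forall n \near \oo, exists B, [/\ measurable B, (P B <= eta%:E)%E &
     forall w t, ~ B w -> `|Zn n w t - Zn n w (p (idx t))| <= e]) ->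
  weak_conv P Zn P' Z.
Proof.
move=> approx h hb.
have [[M hM] _] := hb.
have hc := linf_bcont_cont _ hb.
have M0 : 0 <= M.
  have l0 : linf (fun _ : T => 0 : R) by exists 0 => t; rewrite normr0.
  exact: le_trans (normr_ge0 _) (hM _ l0).
have mh : measurable_fun setT (fun w => h (Z w)) by exact: linf_cont_measurable.
have ih : P'.-integrable setT (EFin \o (fun w => h (Z w))).
  by apply: (bounded_measurable_integrable _ _ M) => // w; exact: hM.
rewrite (_ : (\int[P']_w (h (Z w))%:E)%E = (\int[P']_w h (Z w))%:E); last first.
  by rewrite fineK//; exact: integrable_fin_num.
apply/cvge_fin_near => kap kap0.
have e0 : 0 < kap / 8 by rewrite divr_gt0.
set e := kap / 8 in e0.
have M10 : 0 < M + 1 by lra.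
(* The total error is [3 * e + 22 * M * eta], with 6 from the limit and 16 from [Zn]. As
   [88 = 4 * 22], the second term is at most [kap / 4]; [M + 1] allows [M = 0]. *)
have eta0 : 0 < kap / (88 * (M + 1)) by rewrite divr_gt0 ?mulr_gt0.
set eta := kap / _ in eta0.
have etaM : 22 * M * eta <= kap / 4.
  rewrite /eta mulrA ler_pdivrMr ?mulr_gt0//.
  rewrite (_ : 22 * M * kap = 22 * kap * M); last by ring.
  rewrite (_ : kap / 4 * (88 * (M + 1)) = 22 * kap * (M + 1)); last by field.
  by rewrite ler_wpM2l ?mulr_ge0 ?(ltW kap0)//; lra.
(* The radius comes from [Z] alone, before the projection, whose accuracy must be adapted to it. *)
have [dl3 dl30 [A [mA PA AP]]] := osc_radius_small h e eta hb e0 eta0.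
have dl0 : 0 < dl3 / 3 by rewrite divr_gt0.
set dl := dl3 / 3 in dl0.
have dl3E : dl3 = 3 * dl by rewrite /dl; field.
have dl30' : 0 < dl / 3 by rewrite divr_gt0.
have [k [p [idx Hn]]] := approx (dl / 3) eta dl30' eta0.
have [B' [mB' PB' B'P]] := approx_limit k p idx _ _ _ dl30' eta0 eta0 Hn.
rewrite (_ : 3 * (dl / 3) = dl) in B'P; last by field.
pose pr (x : T -> R) t := x (p (idx t)).
have prl x : linf x -> linf (pr x) by exact: linf_comp.
(* A continuous cutoff, at least 1 where the radius is at most [dl] and 0 where it is at least
   [2 * dl]. Off [A] and [B'] the radius exceeds [3 * dl] at [Z], hence [2 * dl] at [pr Z]. *)
pose psi (x : T -> R) := Num.max 0 (2 - osc_radius h e x / dl).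
have psi0 x : 0 <= psi x by rewrite /psi le_max lexx.
have rc := linf_cont_osc_radius h e hb e0.
have psic : linf_cont psi.
  move=> x xl eps eps0.
  have epsdl : 0 < eps * dl by rewrite mulr_gt0.
  have [c c0 Hc] := rc x xl _ epsdl.
  exists c => // y yl xy.
  have Hr : `|osc_radius h e x - osc_radius h e y| / dl < eps.
    by rewrite ltr_pdivrMr//; exact: Hc.
  apply: le_lt_trans Hr.
  apply: (truncated_dist _ _ _ _).1.
  rewrite (_ : 2 - _ - _ = (osc_radius h e y - osc_radius h e x) / dl); last first.
    by field; rewrite gt_eqF.
  by rewrite normrM (ger0_norm (_ : 0 <= dl^-1)) ?invr_ge0 ?(ltW dl0)// distrC.
have psi2 x : linf x -> psi x <= 2.
  move=> xl; rewrite /psi ge_max ler0n/= gerBl divr_ge0// ?(ltW dl0)//.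
  exact: ltW (osc_radius_gt0 h e hb e0 _ xl).
have psiM x : linf x -> `|psi x| <= 2 by move=> xl; rewrite ger0_norm ?psi2.
have vl (v : 'rV[R]_k) : linf (fun t => v ord0 (idx t)).
  exists (\sum_j `|v ord0 j|) => t.
  by rewrite (bigD1 (idx t))//= lerDl sumr_ge0.
have rowE (x : T -> R) : (fun t => (\row_j x (p j)) ord0 (idx t)) = pr x.
  by apply/funext => t; rewrite mxE.
have proj_conv (f : (T -> R) -> R) (C : R) : linf_cont f -> (forall x, linf x -> `|f x| <= C) ->
    [/\ forall n, P.-integrable setT (EFin \o (fun w => f (pr (Zn n w)))),
        P'.-integrable setT (EFin \o (fun w => f (pr (Z w)))) &
        (fun n => \int[P]_w f (pr (Zn n w))) @ \oo --> \int[P']_w f (pr (Z w))].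
  move=> fc fC.
  pose phi (v : 'rV[R]_k) := f (fun t => v ord0 (idx t)).
  have cphi : continuous phi by exact: continuous_row_comp.
  have phiE (x : T -> R) : phi (\row_j x (p j)) = f (pr x) by rewrite /phi rowE.
  have phiC v : `|phi v| <= C by exact: fC.
  split.
  - move=> n; apply: (bounded_measurable_integrable _ _ C); last by move=> w; apply: fC; exact: prl.
    under eq_fun do rewrite -phiE.
    exact: (measurable_continuous_row (fun j w => Zn n w (p j))).
  - apply: (bounded_measurable_integrable _ _ C); last by move=> w; apply: fC; exact: prl.
    under eq_fun do rewrite -phiE.
    exact: (measurable_continuous_row (fun j w => Z w (p j))).
  - have := fidi_Rintegral k p phi C cphi phiC.
    under eq_fun do under eq_Rintegral do rewrite phiE.
    by under eq_Rintegral do rewrite phiE.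
have [ihn ihpr hconv] := proj_conv h M hc hM.
have [ipsin ipsi psiconv] := proj_conv psi 2 psic psiM.
have iA := indic_integrable P' _ mA; have iB' := indic_integrable P' _ mB'.
have iAB' : P'.-integrable setT (EFin \o (fun w => \1_A w + \1_B' w : R)).
  exact: (integrableD measurableT iA iB').
have iZAB' : P'.-integrable setT (EFin \o (fun w => 2 * M * (\1_A w + \1_B' w) : R)).
  exact: (integrableZl measurableT _ iAB').
have iRHS : P'.-integrable setT (EFin \o (fun w => e + 2 * M * (\1_A w + \1_B' w) : R)).
  exact: (integrableD measurableT (finite_measure_integrable_cst P' e measurableT) iZAB').
have indic01 (S : set Om') w : 0 <= \1_S w :> R by rewrite indicE.
have PAB' : \int[P']_w (\1_A w + \1_B' w) <= 3 * eta.
  rewrite RintegralD// !Rintegral_indic//.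
  have : fine (P' A) <= eta by rewrite -lee_fin fineK ?fin_num_measure.
  have : fine (P' B') <= eta + eta by rewrite -lee_fin fineK ?fin_num_measure.
  lra.
have good w : ~ A w -> ~ B' w -> unif_close (Z w) (pr (Z w)) dl /\ 3 * dl < osc_radius h e (Z w).
  by move=> nA nB'; split; [exact: B'P|rewrite -dl3E; exact: AP].
have indic_case w : (1 <= \1_A w + \1_B' w :> R) \/ (~ A w /\ ~ B' w).
  have [Aw|nA] := pselect (A w).
    by left; rewrite (_ : \1_A w = 1) ?lerDl// indicE mem_set.
  have [Bw|nB] := pselect (B' w); last by right.
  by left; rewrite (_ : \1_B' w = 1) ?lerDr// indicE mem_set.
have psi_lim : \int[P']_w psi (pr (Z w)) <= 6 * eta.
  apply: (@le_trans _ _ (\int[P']_w (2 * (\1_A w + \1_B' w)))); last first.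
    rewrite RintegralZl//; lra.
  apply: le_Rintegral => //; first exact: (integrableZl measurableT _ iAB').
  move=> w _; have [AB|[nA nB]] := indic_case w.
    by apply: le_trans (psi2 _ (prl _ (Zl w))) _; lra.
  have [cl rZ] := good w nA nB.
  have := osc_radius_lip h e hb e0 _ _ _ (Zl w) (prl _ (Zl w)) (ltW dl0) cl => rpr.
  rewrite (_ : psi _ = 0) ?mulr_ge0 ?addr_ge0//.
  apply/max_idPl; rewrite subr_le0 ler_pdivlMr//; lra.
have h_lim : `|\int[P']_w h (Z w) - \int[P']_w h (pr (Z w))| <= e + 6 * M * eta.
  have bnd : `|\int[P']_w h (Z w) - \int[P']_w h (pr (Z w))| <=
      \int[P']_w (e + 2 * M * (\1_A w + \1_B' w)).
    rewrite -RintegralB//.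
    have iD := integrableB measurableT ih ihpr.
    have idiff : P'.-integrable setT (EFin \o (fun w => h (Z w) - h (pr (Z w)))) by exact: iD.
    apply: le_trans (le_normr_Rintegral measurableT idiff) _.
    apply: le_Rintegral => //; first exact: (integrable_norm idiff).
    move=> w _; have [AB|[nA nB]] := indic_case w.
      apply: (@le_trans _ _ (2 * M)).
        apply: le_trans (ler_normB _ _) _.
        have := hM _ (Zl w); have := hM _ (prl _ (Zl w)); lra.
      rewrite -[leLHS]mulr1 -[leLHS]add0r lerD ?(ltW e0)//.
      by rewrite ler_wpM2l// mulr_ge0.
    have [cl rZ] := good w nA nB.
    apply: (@le_trans _ _ e); last by rewrite lerDl !mulr_ge0 ?addr_ge0.
    apply: (osc_radiusP h e hb e0 (Z w) dl) => //; try exact: prl.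
    - lra.
    - by move=> t; rewrite subrr normr0 ltW.
  apply: (le_trans bnd); rewrite RintegralD//; last exact: (finite_measure_integrable_cst P' e measurableT).
  rewrite RintegralZl// Rintegral_prob_cst lerD2l.
  rewrite (_ : 6 * M * eta = 2 * M * (3 * eta)); last by ring.
  by rewrite ler_wpM2l// mulr_ge0.
near=> n.
have : exists B, [/\ measurable B, (P B <= eta%:E)%E &
     forall w t, ~ B w -> `|Zn n w t - Zn n w (p (idx t))| <= dl / 3] by near: n.
move=> [B [mB PB BP]].
have hn : `|\int[P']_w h (pr (Z w)) - \int[P]_w h (pr (Zn n w))| < e.
  by near: n; move/cvgrPdist_lt: hconv => /(_ e e0).
have psin : \int[P]_w psi (pr (Zn n w)) <= 7 * eta.
  have : `|\int[P']_w psi (pr (Z w)) - \int[P]_w psi (pr (Zn n w))| < eta.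
    by near: n; move/cvgrPdist_lt: psiconv => /(_ eta eta0).
  rewrite ltr_distlC => /andP[_]; lra.
have iB := indic_integrable P _ mB.
pose u w : R := e + 2 * M * (\1_B w + psi (pr (Zn n w))).
have iBpsi : P.-integrable setT (EFin \o (fun w => \1_B w + psi (pr (Zn n w)) : R)).
  exact: (integrableD measurableT iB (ipsin n)).
have iZBpsi : P.-integrable setT (EFin \o (fun w => 2 * M * (\1_B w + psi (pr (Zn n w))) : R)).
  exact: (integrableZl measurableT _ iBpsi).
have iu : P.-integrable setT (EFin \o u).
  exact: (integrableD measurableT (finite_measure_integrable_cst P e measurableT) iZBpsi).
have intu : \int[P]_w u w <= e + 16 * M * eta.
  rewrite RintegralD//; last exact: (finite_measure_integrable_cst P e measurableT).
  rewrite RintegralZl// Rintegral_prob_cst lerD2l.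
  rewrite (_ : 16 * M * eta = 2 * M * (8 * eta)); last by ring.
  rewrite ler_wpM2l ?mulr_ge0// RintegralD// Rintegral_indic//.
  have : fine (P B) <= eta by rewrite -lee_fin fineK ?fin_num_measure.
  lra.
have dist_u w : `|h (Zn n w) - h (pr (Zn n w))| <= u w.
  have big : (1 <= \1_B w + psi (pr (Zn n w)) :> R) ->
      `|h (Zn n w) - h (pr (Zn n w))| <= u w.
    move=> b1; apply: (@le_trans _ _ (2 * M)).
      apply: le_trans (ler_normB _ _) _.
      have := hM _ (Znl n w); have := hM _ (prl _ (Znl n w)); lra.
    rewrite -[leLHS]mulr1 -[leLHS]add0r lerD ?(ltW e0)//.
    by rewrite ler_wpM2l// mulr_ge0.
  have [Bw|nB] := pselect (B w).
    by apply: big; rewrite indicE mem_set//= lerDl.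
  (* A small radius makes [psi] at least 1, and the crude bound [2 * M] is paid for. Otherwise [Zn]
     lies in a ball about [pr Zn] on which [h] oscillates by at most [e]. *)
  have [rsmall|rbig] := leP (osc_radius h e (pr (Zn n w))) dl.
    apply: big; apply: (@le_trans _ _ (psi (pr (Zn n w)))); last by rewrite lerDr indicE.
    rewrite /psi le_max; apply/orP; right.
    by rewrite lerBrDr -lerBrDl (_ : 2 - 1 = 1) ?ler_pdivrMr ?mul1r//; ring.
  apply: (@le_trans _ _ e).
    apply: (osc_radiusP h e hb e0 (pr (Zn n w)) dl) => //; try exact: prl.
      apply: unif_closeC => t; apply: le_trans (BP w t nB) _.
      by rewrite ler_pdivrMr// ler_pMr// ler1n.
    by move=> t; rewrite subrr normr0 ltW.
  by rewrite lerDl !mulr_ge0 ?addr_ge0 ?indicE.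
have /andP[E1 E2] := Estar_between P (fun w => h (Zn n w)) _ _ (ihn n) iu dist_u.
have := hn; rewrite ltr_distl => /andP[hn1 hn2].
have := h_lim; rewrite ler_distl => /andP[hl1 hl2].
have e8 : kap = 8 * e by rewrite /e; field.
apply/andP; split.
  apply: lt_le_trans E1; rewrite lte_fin; lra.
apply: le_lt_trans E2 _; rewrite lte_fin; lra.
Unshelve. all: by end_near. Qed.

End weak_convergence.

(** * Finite nets of the index set and the assembled theorem *)

Lemma grid_approx {R : realType} {X : Type} (Fam : set (X -> R))
    (rho : (X -> R) -> (X -> R) -> R) (dl : R) :
  totally_bounded Fam rho -> 0 < dl ->
  exists (k : nat) (p : 'I_k -> IdxT Fam) (idx : IdxT Fam -> 'I_k), forall t,
    `|(sval t).1 - (sval (p (idx t))).1| + rho (sval t).2 (sval (p (idx t))).2 <= dl.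
Proof.
move=> tb dl0; have dl20 : 0 < dl / 2 by rewrite divr_gt0.
have [G [/finite_seqP[s Gs] GF Gd]] := tb _ dl20.
(* The time grid has mesh [1 / (N + 1) < dl / 2]; its [N + 2] points include both endpoints of the
   unit interval. *)
pose N := Num.truncn (dl / 2)^-1.
have N0 : 0 < N.+1%:R :> R by [].
have NP : N.+1%:R^-1 < dl / 2 by rewrite invf_plt ?posrE//; exact: truncnS_gt.
have pP (a : 'I_N.+2 * 'I_(size s)) :
    (0 <= (a.1%:R / N.+1%:R : R) <= 1) /\ Fam (tnth (in_tuple s) a.2).
  split; last by apply: GF; rewrite Gs /=; exact: mem_tnth.
  rewrite divr_ge0//= ler_pdivrMr// mul1r ler_nat -ltnS; exact: ltn_ord.
pose p (a : 'I_N.+2 * 'I_(size s)) : IdxT Fam :=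
  exist _ (a.1%:R / N.+1%:R, tnth (in_tuple s) a.2) (pP a).
have near_grid (t : IdxT Fam) : exists j : 'I_#|{: 'I_N.+2 * 'I_(size s)}|,
    `|(sval t).1 - (sval (p (enum_val j))).1| +
      rho (sval t).2 (sval (p (enum_val j))).2 <= dl.
  case: t => [[u f] [/= /andP[u0 u1] Ff]].
  have [g Gg fg] := Gd f Ff.
  have /tnthP[i gi] : g \in in_tuple s by move: Gg; rewrite Gs.
  have uN : (Num.truncn (N.+1%:R * u) < N.+2)%N.
    by rewrite ltnS truncn_mul_le// u0.
  exists (enum_rank (Ordinal uN, i)); rewrite enum_rankK /= -gi.
  rewrite [leRHS](splitr dl) lerD//; last exact: ltW.
  apply: le_trans (ltW NP).
  have t0 : 0 <= N.+1%:R * u by rewrite mulr_ge0.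
  have /andP[t1 t2] := truncn_itv t0.
  rewrite (_ : u - _ = (N.+1%:R * u - (Num.truncn (N.+1%:R * u))%:R) / N.+1%:R); last first.
    by rewrite mulrBl mulrAC mulfV ?mul1r// gt_eqF.
  rewrite ger0_norm ?divr_ge0 ?subr_ge0//.
  rewrite ler_pdivrMr// mulVf ?gt_eqF//.
  by rewrite lerBlDr addrC natr1 ltW.
have [idx idxP] := choice near_grid.
by exists _, (fun j => p (enum_val j)), idx.
Qed.

Theorem theorem2p3 (R : realType) (d dX : measure_display)
  (Omega : measurableType d) (P : probability Omega R)
  (X : measurableType dX) (Xa : nat -> nat -> Omega -> X)
  (Fam : set (X -> R)) (Fenv : X -> R)
  (rho : (X -> R) -> (X -> R) -> R) (nu : R)
  (g : nat -> R -> R) (h : nat -> R) :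
  (* standing assumptions *)
  (forall n i, (1 <= i <= n)%N -> measurable_fun setT (Xa i n)) ->
  (forall f, Fam f -> measurable_fun setT f) ->
  measurable_fun setT Fenv ->
  (forall f, Fam f -> forall x, `|f x| <= Fenv x) ->
  (forall n i, (1 <= i <= n)%N ->
     P.-integrable setT (fun w => (Fenv (Xa i n w))%:E)) ->
  2 < nu ->
  semimetric Fam rho ->
  (* (1) *)
  (forall n dl i j, 0 < dl -> (1 <= i <= j)%N -> (j <= n)%N ->
     (Estar P (fun w => ereal_sup
        [set ((`|Ssum P Xa n i j f w|) `^ nu)%:E | f in Fdelta Fam rho dl])
      <= ((g (j - i + 1)%N dl) `^ (nu / 2))%:E)%E) ->
  (exists Qg : R, forall dl, 0 < dl -> condS (nu / 2) (fun k => g k dl) Qg) ->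
  (* (2) *)
  (forall n i j, (1 <= i <= j)%N -> (j <= n)%N ->
     (Estar P (fun w => ereal_sup
        [set ((`|Ssum P Xa n i j f w|) `^ nu)%:E | f in Fam])
      <= ((h (j - i + 1)%N) `^ (nu / 2))%:E)%E) ->
  (exists Qh : R, condS (nu / 2) h Qh) ->
  (* (3) *)
  (fun dl => limn_esup (fun n => (g n dl / n%:R)%:E)) @ 0^'+ --> 0%E ->
  (* (4), with the convention h(0) = 0 *)
  (exists C : R, 0 <= C /\ forall e : R, 0 < e <= 1 ->
     (limn_esup (fun n =>
        ((let m := Num.truncn (n%:R * e) in if m == 0%N then 0 else h m)
          / n%:R)%:E) <= (C * e)%:E)%E) ->
  (* conclusion: (AEC) for tau((s,f),(t,f')) = |s - t| + rho f f' *)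
  (forall e : R, 0 < e ->
     (fun dl => limn_esup (fun n => Pstar P
        [set w | (e%:E < ereal_sup [set x | exists (s : R) f (t : R) f',
            [/\ ((0 <= s <= 1) /\ (0 <= t <= 1))%R, Fam f /\ Fam f',
                (`|s - t| + rho f f' <= dl)%R &
                x = (`|Zproc P Xa n s f w - Zproc P Xa n t f' w|)%R%:E]])%E]))
       @ 0^'+ --> 0%E)
  /\
  (* weak convergence from fidi convergence, under total boundedness *)
  (totally_bounded Fam rho ->
   forall (d' : measure_display) (Om' : measurableType d')
     (P' : probability Om' R) (Z : Om' -> IdxT Fam -> R),
     borel_linf Z -> tight P' Z ->
     fidi_conv P (Zsup P Xa Fam) P' Z ->
     weak_conv P (Zsup P Xa Fam) P' Z).
Proof.
move=> mXa mFam mFenv FamF intF nu2 rhoS gE gS hE hS glim hlim.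
(* Each increment passes through [(s, f')]: first a change of function at time [s], then a change of
   time for [f']. *)
have core e eta : 0 < e -> 0 < eta -> exists2 dl0 : R, 0 < dl0 &
    forall dl, 0 < dl < dl0 -> \forall n \near \oo, exists B,
    [/\ measurable B, (P B <= eta%:E)%E &
     forall s t f f' w, 0 <= s <= 1 -> 0 <= t <= 1 -> Fam f -> Fam f' ->
       `|s - t| + rho f f' <= dl -> ~ B w ->
       `|Zproc P Xa n s f w - Zproc P Xa n t f' w| <= e].
  move=> e0 eta0.
  have e20 : 0 < e / 2 by rewrite divr_gt0.
  have eta20 : 0 < eta / 2 by rewrite divr_gt0.
  have [dl1 dl10 H1] := rho_increments P Xa Fam Fenv rho nu mXa mFam FamF intF nu2
    g gE gS glim _ _ e20 eta20.
  have [dl2 dl20 H2] := time_increments P Xa Fam nu nu2 h hE hS hlim _ _ e20 eta20.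
  exists (Num.min dl1 dl2); first by rewrite lt_min dl10.
  move=> dl /andP[dl0]; rewrite lt_min => /andP[dll1 dll2].
  have dl01 : 0 < dl < dl1 by rewrite dl0.
  have dl02 : 0 < dl < dl2 by rewrite dl0.
  move: (H1 dl dl01) (H2 dl dl02); apply: filterS2 => n [B1 [mB1 PB1 B1P]] [B2 [mB2 PB2 B2P]].
  exists (B1 `|` B2); split; first exact: measurableU.
    apply: le_trans (measureU2 _ mB1 mB2) _.
    by rewrite (splitr eta) EFinD leeD.
  move=> s t f f' w s01 t01 Ff Ff' stff' /not_orP[nB1 nB2].
  have [rho0 _ _ _] := rhoS f f' f' Ff Ff' Ff'.
  rewrite (splitr e); apply: le_trans (ler_distD (Zproc P Xa n s f' w) _ _) _.
  apply: lerD.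
    by apply: B1P => //; apply: le_trans stff'; rewrite lerDr.
  by apply: B2P => //; apply: le_trans stff'; rewrite lerDl.
split.
  move=> e e0; apply/cvge_fin_near => eta eta0.
  have eta20 : 0 < eta / 2 by rewrite divr_gt0.
  have [dl0 dl00 H] := core e _ e0 eta20.
  exists dl0 => //= dl dll dlgt0.
  have {}dll : dl < dl0 by move: dll; rewrite /ball_/= sub0r normrN gtr0_norm.
  have dl01 : 0 < dl < dl0 by rewrite dlgt0.
  rewrite sub0r add0r; apply/andP; split.
    apply: (@lt_le_trans _ _ 0%E); first by rewrite lte_fin oppr_lt0.
    apply: limn_esup_ge0 => n; apply: le_ereal_inf_tmp => _ [A _ <-].
    exact: measure_ge0.
  apply: (@le_lt_trans _ _ (eta / 2)%:E); last by rewrite lte_fin; lra.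
  apply: limn_esup_le_near; apply: filterS (H dl dl01) => n [B [mB PB BP]].
  apply: le_trans PB; apply: ereal_inf_lbound; exists B => //; split => // w /=.
  move=> /ereal_sup_gt[_ [s [f [t [f' [[s01 t01] [Ff Ff'] stff' ->]]]]]].
  rewrite lte_fin => ew; apply: contrapT => nB.
  by have := BP s t f f' w s01 t01 Ff Ff' stff' nB; rewrite leNgt ew.
move=> tb d' Om' P' Z bZ tZ fZ.
apply: (weak_conv_of_approx P (Zsup P Xa Fam) P' Z _ _ bZ tZ fZ).
- move=> n w; have [M HM] := Zproc_bounded P Xa Fam Fenv mXa mFam FamF intF n w.
  by exists M => -[[s f] [s01 Ff]]; exact: HM.
- move=> n [[s f] [s01 Ff]].
  exact: (measurable_Zproc P Xa Fam mXa mFam n s f s01 Ff).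
- move=> e eta e0 eta0.
  have [dl0 dl00 H] := core e eta e0 eta0.
  have dl20 : 0 < dl0 / 2 by rewrite divr_gt0.
  have [k [p [idx idxP]]] := grid_approx Fam rho _ tb dl20.
  exists k, p, idx.
  have dl01 : 0 < dl0 / 2 < dl0 by rewrite dl20/= ltr_pdivrMr// ltr_pMr// ltr1n.
  apply: filterS (H _ dl01) => n [B [mB PB BP]]; exists B; split => // w t nB.
  have := idxP t; rewrite /Zsup; case: (p (idx t)) => -[u f'] [/= u01 Ff'].
  case: t => -[s f] [/= s01 Ff] st; exact: BP.
Qed.
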